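(* Let $\Omega\subset\mathbb{C}^d$ be a $\mathbb{C}$-proper convex open set. If $(\Omega,d_\Omega)$ is Gromov hyperbolic, then $\partial\Omega$ contains no non-trivial holomorphic disk, i.e. there is no non-constant holomorphic map $\varphi:\Delta\to\mathbb{C}^d$ with $\varphi(\Delta)\subset\partial\Omega$.
   Context: An open convex set is $\mathbb{C}$-proper if it contains no complex affine line; for such sets the Kobayashi distance $d_\Omega$ is a complete metric. $\Delta$ is the unit disk in $\mathbb{C}$. Gromov hyperbolic: there is $\delta\ge0$ such that every geodesic triangle is $\delta$-thin. *)

(* Defs.v *)
From HB Require Import structures.
From mathcomp Require Import all_boot all_order all_algebra.
From mathcomp Require Import all_classical all_reals all_analysis.
From mathcomp Require Export complex.
Import Order.TTheory GRing.Theory Num.Theory.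
Import numFieldNormedType.Exports.

Set Implicit Arguments.
Unset Strict Implicit.
Unset Printing Implicit Defensive.

Local Open Scope ring_scope.
Local Open Scope classical_set_scope.

Definition Cplx (R : realType) := (R[i])^o.
Definition Cd (R : realType) (d : nat) := 'rV[Cplx R]_d.

Definition cmod (R : realType) (z : Cplx R) : R := @complex.Re R (`|z| : R[i]).

Definition unit_disk (R : realType) : set (Cplx R) := [set z | cmod z < 1].
Arguments unit_disk R : clear implicits.

(* f is holomorphic on the open set D: complex differentiable at every
   point of D (derivative taken over the field C). *)
Definition holomorphic_on (R : realType) (d : nat)
    (D : set (Cplx R)) (f : Cplx R -> Cd R d) : Prop :=
  forall z, D z -> derivable f z 1.

Definition convex_set_Cd (R : realType) (d : nat) (O : set (Cd R d)) : Prop :=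
  forall x y, O x -> O y -> forall t : R, 0 <= t <= 1 ->
    O (((1 - t)%:C)%C *: x + ((t%:C)%C) *: y).

Definition C_proper (R : realType) (d : nat) (O : set (Cd R d)) : Prop :=
  ~ exists (a v : Cd R d), v != 0 /\ forall z : Cplx R, O (a + z *: v).

Definition bdry (R : realType) (d : nat) (O : set (Cd R d)) : set (Cd R d) :=
  closure O `\` interior O.

(* Poincare distance on the disk from 0 to t: artanh |t| *)
Definition poincare0 (R : realType) (t : Cplx R) : R :=
  2^-1 * ln ((1 + cmod t) / (1 - cmod t)).

Definition kob_chain (R : realType) (d : nat) (O : set (Cd R d))
    (x y : Cd R d) (s : R) : Prop :=
  exists (n : nat) (p : nat -> Cd R d) (t : nat -> Cplx R)
         (f : nat -> Cplx R -> Cd R d),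
    [/\ p 0%N = x, p n = y,
        (forall i, (i < n)%N ->
           [/\ holomorphic_on (unit_disk R) (f i),
               f i @` unit_disk R `<=` O,
               unit_disk R (t i),
               f i 0 = p i & f i (t i) = p i.+1])
      & s = \sum_(i < n) poincare0 (t i)].

Definition kobayashi (R : realType) (d : nat) (O : set (Cd R d))
    (x y : Cd R d) : R :=
  inf [set s | kob_chain O x y s].

Definition geodesic (R : realType) (T : Type) (S : set T)
    (dist : T -> T -> R) (sigma : R -> T) (a b : R) (x y : T) : Prop :=
  [/\ a <= b, sigma a = x, sigma b = y,
      (forall s, a <= s <= b -> S (sigma s)) &
      (forall s t, a <= s <= b -> a <= t <= b ->
         dist (sigma s) (sigma t) = `|s - t|)].

Definition seg_img (R : realType) (T : Type) (sigma : R -> T) (a b : R) : set T :=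
  sigma @` [set s | a <= s <= b].

Definition side_close (R : realType) (T : Type) (dist : T -> T -> R)
    (delta : R) (A B C : set T) : Prop :=
  forall p, A p -> exists q, (B `|` C) q /\ dist p q <= delta.

Definition gromov_hyperbolic (R : realType) (T : Type) (S : set T)
    (dist : T -> T -> R) : Prop :=
  exists delta : R, 0 <= delta /\
    forall (x y z : T) (s1 s2 s3 : R -> T) (a1 b1 a2 b2 a3 b3 : R),
      geodesic S dist s1 a1 b1 x y ->
      geodesic S dist s2 a2 b2 y z ->
      geodesic S dist s3 a3 b3 z x ->
      let A1 := seg_img s1 a1 b1 in
      let A2 := seg_img s2 a2 b2 in
      let A3 := seg_img s3 a3 b3 in
      [/\ side_close dist delta A1 A2 A3,
          side_close dist delta A2 A3 A1 &
          side_close dist delta A3 A1 A2].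

(* Main.v *)
(* Suppose the boundary of Omega contains a holomorphic disk.  The Schwarz lemma,
   applied to every supporting functional, shows that
   phi(0) + z (1 - |t|) (phi(t) - phi(0)) / (2 |t|) lies in the closure of Omega for
   |z| <= 1, so the boundary contains an affine disk p + z v; rescale v so that the
   open unit disk is maximal.  With x in Omega, the points
   X(s, z) = (1 - s) (p + z v) + s x behave like a Euclidean quadrant for the
   sup-distance: a disk moving in s and z at once costs only the larger of the two
   moves, supporting functionals at points p + z v outside the closure bound
   horizontal distances sharply from below, and a supporting functional at p bounds
   vertical distances from below.  Hence a long horizontal side Y W has two almost
   midpoints, at different heights s, which are arbitrarily far apart, whereas in a
   hyperbolic geodesic space almost midpoints are at bounded distance.

   Thinness of triangles only has content for actual geodesics, so these are
   constructed: C-properness makes Kobayashi balls relatively compact, and an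
   ultrafilter limit of almost geodesics is a geodesic.  The complex analysis rests
   on a discrete form of Goursat's bisection argument, which needs no integral. *)
Require Import Defs.
From HB Require Import structures.
From mathcomp Require Import all_boot all_order all_algebra.
From mathcomp Require Import all_classical all_reals all_analysis.
From mathcomp Require Import complex.
From mathcomp Require Import ring lra zify.
Import Order.TTheory GRing.Theory Num.Theory.
Import numFieldNormedType.Exports.
Local Open Scope ring_scope.
Local Open Scope classical_set_scope.

Set Implicit Arguments.
Unset Strict Implicit.
Unset Printing Implicit Defensive.

(** * The real norm and complex differentiability *)

(** The order of the choices carries the argument. The rate b at which a chain may climb depends
    only on x, p and |v|, not on the height. Then delta fixes the number N of steps, and N fixes how
    close to the unit circle the outside point must be. Only then is the height s chosen, so low
    that the slice at height s still misses this outside point and s b^N is at most 1. The direction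
    of the outside point depends on N, so the disk is rotated for each N; this changes neither |v|
    nor b.

    Chains advance by the disk parameter 1/2, of Poincare length ln 3 / 2: this is the origin of the
    powers of 3. With a = N ln 3 / 2 the four sides of the quadrilateral are at most a, the diagonal
    Y W is at least 2 a - ln 3 / 2, and the other diagonal is at least N ln b / 2; hyperbolicity
    would bound N ln b.

    Distances are infima over chains of disks. Upper bounds therefore come from explicit disks, and
    lower bounds from the Schwarz lemma for a half-plane, multiplied along a chain; no infinitesimal
    metric occurs. *)

Section RealNorm.
Variable R : realType.
Local Notation C := (Cplx R).

(** The norm of a normed module over C is itself a nonnegative element of C; all estimates need it
    as a real number. *)
Definition rnorm (V : normedModType C) (x : V) : R := complex.Re (`|x| : R[i]).
Arguments rnorm {V} x.

Lemma rnormE (V : normedModType C) (x : V) : `|x| = ((rnorm x)%:C)%C :> C.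
Proof. by rewrite /rnorm RRe_real // ger0_real. Qed.

Lemma rnorm_ge0 (V : normedModType C) (x : V) : 0 <= rnorm x.
Proof. by rewrite -(@ler0c R) -rnormE. Qed.

Lemma rnormD (V : normedModType C) (x y : V) : rnorm (x + y) <= rnorm x + rnorm y.
Proof. by rewrite -(@lecR R) rmorphD/= -!rnormE ler_normD. Qed.

Lemma rnormN (V : normedModType C) (x : V) : rnorm (- x) = rnorm x.
Proof. by rewrite /rnorm normrN. Qed.

Lemma rnormB (V : normedModType C) (x y : V) : rnorm (x - y) <= rnorm x + rnorm y.
Proof. by rewrite -(rnormN y) rnormD. Qed.

Lemma rnormBC (V : normedModType C) (x y : V) : rnorm (x - y) = rnorm (y - x).
Proof. by rewrite -rnormN opprB. Qed.

Lemma rnormZ (V : normedModType C) (a : C) (x : V) :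
  rnorm (a *: x) = cmod a * rnorm x.
Proof.
apply: (@complexI R); rewrite rmorphM/= -!rnormE normrZ; congr (_ * _).
Qed.

Lemma rnorm0 (V : normedModType C) : rnorm (0 : V) = 0.
Proof. by rewrite /rnorm normr0. Qed.

Lemma rnorm_eq0 (V : normedModType C) (x : V) : (rnorm x == 0) = (x == 0).
Proof. by rewrite -(normr_eq0 x) rnormE -(inj_eq (@complexI R)). Qed.

Lemma rnorm_gt0 (V : normedModType C) (x : V) : (0 < rnorm x) = (x != 0).
Proof. by rewrite lt_def rnorm_eq0 rnorm_ge0 andbT. Qed.

Lemma cmodE (z : C) : cmod z = rnorm z. Proof. by []. Qed.

Lemma cmod_ge0 (z : C) : 0 <= cmod z. Proof. exact: (rnorm_ge0 z). Qed.

Lemma cmodD (x y : C) : cmod (x + y) <= cmod x + cmod y.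
Proof. exact: (@rnormD C). Qed.

Lemma cmodB (x y : C) : cmod (x - y) <= cmod x + cmod y.
Proof. exact: (@rnormB C). Qed.

Lemma cmodN (x : C) : cmod (- x) = cmod x.
Proof. exact: (@rnormN C). Qed.

Lemma cmod0 : cmod (0 : C) = 0.
Proof. exact: (@rnorm0 C). Qed.

Lemma cmod_eq0 (x : C) : (cmod x == 0) = (x == 0).
Proof. exact: (@rnorm_eq0 C). Qed.

Lemma cmod_gt0 (x : C) : (0 < cmod x) = (x != 0).
Proof. exact: (@rnorm_gt0 C). Qed.

Lemma cmodM (a b : C) : cmod (a * b) = cmod a * cmod b.
Proof. exact: (@rnormZ C). Qed.

Lemma cmod1 : cmod (1 : C) = 1.
Proof. by rewrite /cmod normr1. Qed.

Lemma cmodX (a : C) n : cmod (a ^+ n) = cmod a ^+ n.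
Proof. by elim: n => [|n IH]; rewrite ?expr0 ?cmod1// !exprS cmodM IH. Qed.

Lemma cmodV (a : C) : cmod (a^-1) = (cmod a)^-1.
Proof.
have [->|a0] := eqVneq a 0; first by rewrite invr0 cmodE rnorm0 invr0.
apply: (@mulfI _ (cmod a)); first by rewrite cmodE rnorm_eq0.
by rewrite -cmodM divff // divff ?cmod1 // cmodE rnorm_eq0.
Qed.

Lemma cmod_real (x : R) : cmod ((x%:C)%C : C) = `|x|.
Proof. by rewrite /cmod normc_def/= expr0n/= addr0 sqrtr_sqr. Qed.

Lemma cmod_sqr (z : C) : cmod z ^+ 2 = complex.Re z ^+ 2 + complex.Im z ^+ 2.
Proof. by rewrite /cmod normc_def/= sqr_sqrtr // addr_ge0 // sqr_ge0. Qed.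

Lemma Re_le_cmod (z : C) : `|complex.Re z| <= cmod z.
Proof. by rewrite -(@lecR R) cmodE -rnormE normc_ge_Re. Qed.

Lemma Im_le_cmod (z : C) : `|complex.Im z| <= cmod z.
Proof.
rewrite -sqrtr_sqr -[leRHS](ger0_norm (rnorm_ge0 z)) -sqrtr_sqr ler_wsqrtr//.
by rewrite cmod_sqr lerDr sqr_ge0.
Qed.

Lemma cmod_le_ReIm (z : C) : cmod z <= `|complex.Re z| + `|complex.Im z|.
Proof.
rewrite -(@ler_pXn2r _ 2) ?nnegrE ?addr_ge0?cmod_ge0//.
rewrite cmod_sqr sqrrD !real_normK ?num_real// lerD2r lerDl.
by rewrite mulrn_wge0// mulr_ge0.
Qed.

Lemma rnorm_nbhs (V : normedModType C) (x : V) (A : set V) :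
  nbhs x A <-> exists2 e : R, 0 < e & forall y, rnorm (y - x) < e -> A y.
Proof.
split => [/nbhs_ballP[e /= e0]|[e e0 eA]].
  rewrite -ball_normE => eA.
  have eR : ((complex.Re e)%:C)%C = e by rewrite RRe_real // gtr0_real.
  exists (complex.Re e) => [|y yx]; first by rewrite -(@ltcR R) eR.
  by apply: eA => /=; rewrite rnormE -eR ltcR rnormBC.
apply/nbhs_ballP; exists ((e%:C)%C) => /=; first by rewrite (@ltcR R 0 e).
rewrite -ball_normE.
by move=> y /=; rewrite rnormE ltcR rnormBC => /eA.
Qed.

Lemma rnorm_cvg (V : normedModType C) (T : Type) (F : set_system T) (f : T -> V) (l : V) :
  Filter F ->
  (f @ F --> l) <-> (forall e : R, 0 < e -> F [set t | rnorm (f t - l) < e]).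
Proof.
move=> FF; split => [fl e e0|H A /rnorm_nbhs[e e0 eA]].
  by apply: (fl [set y | rnorm (y - l) < e]); apply/rnorm_nbhs; exists e.
by apply: filterS (H e e0) => t; apply: eA.
Qed.

Lemma rnorm_cont (V : normedModType C) (z : C) (f : C -> V) :
  {for z, continuous f} <->
  forall e : R, 0 < e -> exists2 r : R, 0 < r &
     forall w, cmod (w - z) < r -> rnorm (f w - f z) < e.
Proof.
rewrite /prop_for /continuous_at (rnorm_cvg _ _ (nbhs_filter z)); split => H e e0; have := H e e0.
  by move/rnorm_nbhs => [r r0 rA]; exists r.
by move=> [r r0 rA]; apply/rnorm_nbhs; exists r.
Qed.

Lemma rnorm_coord d (x : Cd R d) (i : 'I_d) : cmod (x 0 i) <= rnorm x.
Proof.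
rewrite -(@lecR R) -rnormE cmodE -rnormE [leRHS]/Num.Def.normr/= mx_normE.
by rewrite -[leLHS]nngE num_le; exact: (le_bigmax _ _ (0, i)).
Qed.

Lemma rnorm_row_lt d (x : Cd R d) (e : R) :
  0 < e -> (forall i, cmod (x 0 i) < e) -> rnorm x < e.
Proof.
move=> e0 xe; rewrite ltNge; apply/negP => ex.
have x0 : mx_norm x != 0.
  apply/eqP => x0; move: ex; rewrite leNgt => /negP; apply.
  by rewrite /rnorm [`|x|]/Num.Def.normr/= x0.
have [[j i] xi] := mx_norm_neq0 x0; move: (xe i); rewrite ltNge => /negP; apply.
by move: ex; rewrite /rnorm [`|x|]/Num.Def.normr/= xi/= (ord1 j).
Qed.

Lemma cmod_sum (I : finType) (F : I -> C) :
  cmod (\sum_i F i) <= \sum_i cmod (F i).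
Proof.
elim/big_ind2 : _ => [|a b c e ab ce|//]; first by rewrite cmodE rnorm0.
by apply: le_trans (lerD ab ce); rewrite !cmodE rnormD.
Qed.

Lemma cmod_lin d (x : Cd R d) (A : 'cV[C]_d) :
  cmod ((x *m A) 0 0) <= rnorm x * \sum_i cmod (A i 0).
Proof.
rewrite mxE; apply: le_trans (cmod_sum _) _; rewrite mulr_sumr ler_sum// => i _.
by rewrite cmodM ler_wpM2r ?cmod_ge0// rnorm_coord.
Qed.

Lemma continuous_lin d (f : C -> Cd R d) (z : C) (A : 'cV[C]_d) :
  {for z, continuous f} -> {for z, continuous (fun w => (f w *m A) 0 0 : C)}.
Proof.
move=> fz; apply/rnorm_cont => e e0; pose M := 1 + \sum_i cmod (A i 0).
have M0 : 0 < M by rewrite ltr_wpDr// sumr_ge0// => i _; exact: cmod_ge0.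
have /rnorm_cont/(_ (e / M))[|r r0 rf] := fz; first exact: divr_gt0.
exists r => // w /rf wr.
have -> : (f w *m A) 0 0 - (f z *m A) 0 0 = ((f w - f z) *m A) 0 0.
  by rewrite mulmxBl !mxE.
rewrite -cmodE; apply: le_lt_trans (cmod_lin _ _) _.
rewrite -(divfK (lt0r_neq0 M0) e); apply: le_lt_trans (_ : rnorm (f w - f z) * M < _).
  by rewrite ler_wpM2l ?rnorm_ge0// lerDr.
by rewrite ltr_pM2r.
Qed.

(* Caratheodory form of complex differentiability: products, inverses and
   compositions then reduce to continuity of the difference quotient. *)
Definition cdiff (V : normedModType C) (f : C -> V) (z : C) : Prop :=
  exists q : C -> V, {for z, continuous q} /\
    forall w, f w = f z + (w - z) *: q w.

Lemma cdiff_derivable (V : normedModType C) (f : C -> V) (z : C) :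
  cdiff f z <-> derivable f z 1.
Proof.
rewrite /derivable; split => [[q [qz fE]]|].
  apply/cvg_ex; exists (q z); apply/rnorm_cvg => e e0.
  have /rnorm_cont/(_ e e0)[r r0 rq] := qz.
  apply/rnorm_nbhs; exists r => // h; rewrite subr0 => hr h0 /=.
  rewrite /shift/= [h *: _]mulr1 (fE (h + z)) addrK addrAC subrr add0r.
  by rewrite scalerA mulVf// scale1r; apply: rq; rewrite addrK.
move=> /cvg_ex[l /= fl].
pose q w := if w == z then l else (w - z)^-1 *: (f w - f z).
exists q; split; last first.
  move=> w; rewrite /q; case: eqVneq => [->|wz].
    by rewrite subrr scale0r addr0.
  by rewrite scalerA divff ?subr_eq0// scale1r addrC subrK.
apply/rnorm_cont => e e0.
have /rnorm_cvg/(_ e e0)/rnorm_nbhs[r r0 rq] := fl.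
exists r => // w wr; rewrite {2}/q eqxx /q; case: eqVneq => [_|wz].
  by rewrite subrr rnorm0.
have := rq (w - z); rewrite subr0 => /(_ wr); rewrite /= subr_eq0 => /(_ wz).
by rewrite /shift/= [_ *: 1]mulr1 subrK.
Qed.

Lemma cdiff_cont (V : normedModType C) (f : C -> V) (z : C) :
  cdiff f z -> {for z, continuous f}.
Proof.
move=> [q [qz fE]]; have -> : f = (fun w => f z + (w - z) *: q w).
  exact/funext.
apply: (@continuousD _ _ _ (fun=> f z) (fun w => (w - z) *: q w)).
  exact: cst_continuous.
apply: continuousZ => //; apply: (@continuousB _ _ _ id (fun=> z)).
  exact: cvg_id.
exact: cst_continuous.
Qed.

Lemma cdiff_cst (V : normedModType C) (v : V) (z : C) : cdiff (fun=> v) z.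
Proof.
exists (fun=> 0); split; first exact: cst_continuous.
by move=> w; rewrite scaler0 addr0.
Qed.

Lemma cdiff_id (z : C) : cdiff (fun w : C => w) z.
Proof.
exists (fun=> 1); split; first exact: cst_continuous.
by move=> w; rewrite [_ *: 1]mulr1 addrC subrK.
Qed.

Lemma cdiffD (V : normedModType C) (f g : C -> V) (z : C) :
  cdiff f z -> cdiff g z -> cdiff (fun w => f w + g w) z.
Proof.
move=> [q [qz fE]] [r [rz gE]]; exists (fun w => q w + r w); split.
  exact: (@continuousD _ _ _ q r).
by move=> w; rewrite (fE w) (gE w) scalerDr addrACA.
Qed.

Lemma cdiffZ (V : normedModType C) (f : C -> C) (g : C -> V) (z : C) :
  cdiff f z -> cdiff g z -> cdiff (fun w => f w *: g w) z.
Proof.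
move=> fz [r [rz gE]]; have fc := cdiff_cont fz; case: fz => q [qz fE].
exists (fun w => q w *: g z + f w *: r w); split.
  apply: (@continuousD _ _ _ (fun w => q w *: g z) (fun w => f w *: r w)).
    by apply: continuousZ => //; exact: cst_continuous.
  exact: (@continuousZ _ _ _ f r z fc rz).
move=> w; rewrite (gE w) [in LHS]scalerDr scalerDr addrA; congr (_ + _).
  by rewrite {1}(fE w) scalerDl scalerA.
by rewrite !scalerA mulrC.
Qed.

Lemma cdiffM (f g : C -> C) (z : C) :
  cdiff f z -> cdiff g z -> cdiff (fun w => f w * g w) z.
Proof. exact: cdiffZ. Qed.

Lemma cdiffN (V : normedModType C) (f : C -> V) (z : C) :
  cdiff f z -> cdiff (fun w => - f w) z.
Proof.
move=> fz; have -> : (fun w => - f w) = (fun w => (-1 : C) *: f w).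
  by apply/funext => w; rewrite scaleN1r.
by apply: cdiffZ => //; exact: cdiff_cst.
Qed.

Lemma cdiffB (V : normedModType C) (f g : C -> V) (z : C) :
  cdiff f z -> cdiff g z -> cdiff (fun w => f w - g w) z.
Proof. by move=> fz gz; apply: cdiffD => //; exact: cdiffN. Qed.

Lemma cdiffX (f : C -> C) (z : C) n : cdiff f z -> cdiff (fun w => f w ^+ n) z.
Proof.
move=> fz; elim: n => [|n IH]; first exact: cdiff_cst.
by under eq_fun do rewrite exprS; exact: cdiffM.
Qed.

Lemma cdiffV (f : C -> C) (z : C) :
  f z != 0 -> cdiff f z -> cdiff (fun w => (f w)^-1) z.
Proof.
move=> f0 fz; have fc := cdiff_cont fz; case: fz => q [qz fE].
(* The difference quotient of the inverse. Where [f w] is 0 the inverse is 0 by convention and needs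
   its own formula; near [z] this branch never occurs. *)
pose r (w : C) : C := if f w == 0 then (if w == z then 0 else - (f z)^-1 / (w - z))
  else - q w * (f w)^-1 * (f z)^-1.
exists r; split.
  have H2 : {for z, continuous (fun w => - q w * (f w)^-1 * (f z)^-1)}.
    apply: (@continuousM _ _ (fun w => - q w * (f w)^-1) (fun=> (f z)^-1)).
      apply: (@continuousM _ _ (fun w => - q w) (fun w => (f w)^-1)).
        exact: continuousN.
      exact: (@continuousV _ _ f z f0 fc).
    exact: cst_continuous.
  have /rnorm_cont/(_ (rnorm (f z)))[|s s0 sf] := fc; first by rewrite rnorm_gt0.
  apply/rnorm_cont => e e0; have /rnorm_cont/(_ e e0)[t t0 tH] := H2.
  exists (Num.min s t) => [|w]; first by rewrite lt_min s0.
  rewrite lt_min => /andP[/sf ws /tH]; rewrite /r (negbTE f0).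
  by case: eqP => // w0; move: ws; rewrite w0 sub0r rnormN ltxx.
move=> w; rewrite /r; case: eqVneq => [w0|w0].
  case: eqVneq => [wz|wz]; first by rewrite -wz w0 eqxx in f0.
  rewrite w0 invr0 [_ *: _]mulrCA divff ?subr_eq0// mulr1 subrr//.
have {1}-> : (f w)^-1 = (f z)^-1 + (f z - f w) / (f w * f z) by field; rewrite w0 f0.
by congr (_ + _); rewrite (fE w) opprD addNKr /GRing.scale/=; field; rewrite -(fE w) w0 f0.
Qed.

Lemma cdiff_comp (V : normedModType C) (f : C -> V) (m : C -> C) (z : C) :
  cdiff m z -> cdiff f (m z) -> cdiff (fun w => f (m w)) z.
Proof.
move=> mz [q [qz fE]]; have mc := cdiff_cont mz; case: mz => r [rz mE].
exists (fun w => r w *: q (m w)); split.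
  exact: (@continuousZ _ _ _ r (q \o m) z rz (@continuous_comp _ _ _ m q z mc qz)).
by move=> w; rewrite (fE (m w)) {1}(mE w) addrAC subrr add0r scalerA.
Qed.

Lemma cdiff_coord d (f : C -> Cd R d) (z : C) (A : 'cV[C]_d) :
  cdiff f z -> cdiff (fun w => (f w *m A) 0 0 : C) z.
Proof.
move=> [q [qz fE]]; exists (fun w => (q w *m A) 0 0); split.
  exact: continuous_lin.
by move=> w; rewrite {1}(fE w) mulmxDl -scalemxAl !mxE.
Qed.

End RealNorm.
Arguments rnorm {R V} x.

(** * Contour sums and Goursat's lemma *)

Section Goursat.
Variable R : realType.
Local Notation C := (Cplx R).

Definition r2c (t : R) : C := (t%:C)%C.

Lemma r2cD (s t : R) : r2c (s + t) = r2c s + r2c t. Proof. exact: rmorphD. Qed.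
Lemma r2cB (s t : R) : r2c (s - t) = r2c s - r2c t. Proof. exact: rmorphB. Qed.
Lemma r2cN (t : R) : r2c (- t) = - r2c t. Proof. exact: rmorphN. Qed.
Lemma r2cM (s t : R) : r2c (s * t) = r2c s * r2c t. Proof. exact: rmorphM. Qed.
Lemma r2cV (t : R) : r2c t^-1 = (r2c t)^-1. Proof. exact: fmorphV. Qed.
Lemma r2cX (t : R) n : r2c (t ^+ n) = (r2c t) ^+ n. Proof. exact: rmorphXn. Qed.
Lemma r2c1 : r2c 1 = 1. Proof. exact: rmorph1. Qed.
Lemma r2c0 : r2c 0 = 0. Proof. exact: rmorph0. Qed.
Lemma r2cn n : r2c n%:R = n%:R. Proof. exact: rmorph_nat. Qed.
Definition r2cE := (r2cD, r2cB, r2cN, r2cM, r2cV, r2cX, r2c1, r2c0, r2cn).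

Lemma cmod_r2c (t : R) : cmod (r2c t) = `|t|. Proof. exact: cmod_real. Qed.

Lemma cReD (x y : C) : complex.Re (x + y) = complex.Re x + complex.Re y.
Proof. by case: x y => ? ? []. Qed.
Lemma cImD (x y : C) : complex.Im (x + y) = complex.Im x + complex.Im y.
Proof. by case: x y => ? ? []. Qed.
Lemma cReN (x : C) : complex.Re (- x) = - complex.Re x.
Proof. by case: x. Qed.
Lemma cImN (x : C) : complex.Im (- x) = - complex.Im x.
Proof. by case: x. Qed.
Lemma cReM (x y : C) : complex.Re (x * y) =
  complex.Re x * complex.Re y - complex.Im x * complex.Im y.
Proof. by case: x y => ? ? []. Qed.
Lemma cImM (x y : C) : complex.Im (x * y) =
  complex.Re x * complex.Im y + complex.Im x * complex.Re y.
Proof. by case: x y => ? ? []. Qed.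
Lemma Re_r2c (t : R) : complex.Re (r2c t) = t. Proof. by []. Qed.
Lemma Im_r2c (t : R) : complex.Im (r2c t) = 0. Proof. by []. Qed.
Lemma cReV (x : C) : complex.Re (x^-1) = complex.Re x / cmod x ^+ 2.
Proof. by rewrite cmod_sqr; case: x. Qed.
Lemma cImV (x : C) : complex.Im (x^-1) = - complex.Im x / cmod x ^+ 2.
Proof. by rewrite cmod_sqr; case: x => a b /=; rewrite mulNr. Qed.
Definition ReImE := (cReD, cImD, cReN, cImN, cReM, cImM, Re_r2c, Im_r2c).

(* Trapezoid rule for the integral of g over [p, p + v] with 2^N subintervals:
   bisection is an exact identity and affine functions are integrated exactly. *)
Fixpoint trapezoid (g : C -> C) (N : nat) (p v : C) : C :=
  if N is n.+1 then trapezoid g n p (v / 2) + trapezoid g n (p + v / 2) (v / 2)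
  else (g p + g (p + v)) / 2 * v.

(** The corners are visited in the order p, p + u, p + u + v, p + v; the last two sides are run
    backwards, hence subtracted. *)
Definition contour (g : C -> C) (N : nat) (p u v : C) : C :=
  trapezoid g N p u + trapezoid g N (p + u) v
  - trapezoid g N (p + v) u - trapezoid g N p v.

Lemma trapezoid_affine (a b : C) N p v :
  trapezoid (fun z => a + b * z) N p v = (a + b * (p + v / 2)) * v.
Proof.
elim: N p v => [|N IH] p v /=; first by field.
by rewrite !IH; field.
Qed.

Lemma trapezoidB (g h : C -> C) N p v :
  trapezoid (fun z => g z - h z) N p v = trapezoid g N p v - trapezoid h N p v.
Proof.
elim: N p v => [|N IH] p v /=; first by ring.
by rewrite !IH; ring.
Qed.

Lemma trapezoidZ (c : C) (g : C -> C) N p v :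
  trapezoid (fun z => c * g z) N p v = c * trapezoid g N p v.
Proof.
elim: N p v => [|N IH] p v /=; first by ring.
by rewrite !IH; ring.
Qed.

Lemma half_itv (t : R) : 0 <= t <= 1 -> 0 <= t / 2 <= 1 /\ 0 <= (1 + t) / 2 <= 1.
Proof. by move=> /andP[? ?]; split; apply/andP; split; lra. Qed.

Lemma trapezoid_bound (g : C -> C) (M : R) N p v :
  (forall t, 0 <= t <= 1 -> cmod (g (p + r2c t * v)) <= M) ->
  cmod (trapezoid g N p v) <= M * cmod v.
Proof.
elim: N p v => [|N IH] p v gM /=.
  rewrite cmodM ler_wpM2r ?cmod_ge0// cmodM cmodV.
  have -> : cmod (2 : C) = 2 by rewrite -r2cn cmod_r2c normr_nat.
  rewrite ler_pdivrMr// mulr_natr mulr2n; apply: le_trans (cmodD _ _) _.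
  apply: lerD; first by have := gM 0; rewrite r2c0 mul0r addr0; apply; rewrite lexx ler01.
  by have := gM 1; rewrite r2c1 mul1r; apply; rewrite lexx ler01.
have h2 : cmod (v / 2) = cmod v / 2.
  by rewrite cmodM cmodV -r2cn cmod_r2c normr_nat.
have -> : M * cmod v = M * cmod (v / 2) + M * cmod (v / 2) by rewrite h2; lra.
apply: le_trans (cmodD _ _) _; apply: lerD; apply: IH => t /half_itv[t1 t2].
  have -> : p + r2c t * (v / 2) = p + r2c (t / 2) * v by rewrite !r2cE; ring.
  exact: gM.
have -> : p + v / 2 + r2c t * (v / 2) = p + r2c ((1 + t) / 2) * v by rewrite !r2cE; ring.
exact: gM.
Qed.

(** Meant for 1 / (z - a): it keeps the contour sums away from 0 uniformly in [N], which replaces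
    the value of the integral. *)
Lemma trapezoid_Im (g : C -> C) (m : R) N p v :
  (forall t, 0 <= t <= 1 -> m <= complex.Im (g (p + r2c t * v) * v)) ->
  m <= complex.Im (trapezoid g N p v).
Proof.
elim: N p v m => [|N IH] p v m gM /=.
  have := gM 0; rewrite r2c0 mul0r addr0 lexx ler01 => /(_ isT) g0.
  have := gM 1; rewrite r2c1 mul1r lexx ler01 => /(_ isT) g1.
  have -> : (g p + g (p + v)) / 2 * v = r2c 2^-1 * (g p * v + g (p + v) * v).
    by rewrite !r2cE; ring.
  by rewrite cImM Im_r2c Re_r2c mul0r addr0 cImD; lra.
have -> : m = m / 2 + m / 2 by lra.
rewrite cImD; apply: lerD; apply: IH => t /half_itv[t1 t2].
  have -> : p + r2c t * (v / 2) = p + r2c (t / 2) * v by rewrite !r2cE; ring.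
  rewrite mulrA [g _ * _ * _]mulrC -r2cn -r2cV cImM Im_r2c Re_r2c mul0r addr0 mulrC.
  by rewrite ler_pM2l//; exact: gM.
have -> : p + v / 2 + r2c t * (v / 2) = p + r2c ((1 + t) / 2) * v by rewrite !r2cE; ring.
rewrite mulrA [g _ * _ * _]mulrC -r2cn -r2cV cImM Im_r2c Re_r2c mul0r addr0 mulrC.
by rewrite ler_pM2l//; exact: gM.
Qed.

(** The inner sides cancel exactly, because a sum of level [N.+1] is by definition the sum of its
    two halves of level [N]. *)
Lemma contour_split g N p u v : contour g N.+1 p u v =
  contour g N p (u / 2) (v / 2) + contour g N (p + u / 2) (u / 2) (v / 2) +
  contour g N (p + v / 2) (u / 2) (v / 2) +
  contour g N (p + u / 2 + v / 2) (u / 2) (v / 2).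
Proof.
rewrite /contour /=.
have -> : p + u / 2 + u / 2 = p + u by field.
have -> : p + v / 2 + v / 2 = p + v by field.
have -> : p + v / 2 + u / 2 = p + u / 2 + v / 2 by ring.
have -> : p + u / 2 + v / 2 + u / 2 = p + u + v / 2 by field.
have -> : p + u / 2 + v / 2 + v / 2 = p + v + u / 2 by field.
ring.
Qed.

Lemma contour_affine a b N p u v : contour (fun z => a + b * z) N p u v = 0.
Proof. by rewrite /contour !trapezoid_affine; field. Qed.

Lemma contourB g h N p u v :
  contour (fun z => g z - h z) N p u v = contour g N p u v - contour h N p u v.
Proof. by rewrite /contour !trapezoidB; ring. Qed.

Lemma contourZ c g N p u v :
  contour (fun z => c * g z) N p u v = c * contour g N p u v.
Proof. by rewrite /contour !trapezoidZ; ring. Qed.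

Lemma contour_bound (g : C -> C) (M : R) N p u v :
  (forall s t : R, 0 <= s <= 1 -> 0 <= t <= 1 ->
     [\/ s = 0, s = 1, t = 0 | t = 1] ->
     cmod (g (p + r2c s * u + r2c t * v)) <= M) ->
  cmod (contour g N p u v) <= M * (2 * (cmod u + cmod v)).
Proof.
move=> gM; have I0 : 0 <= (0 : R) <= 1 by rewrite lexx ler01.
have I1 : 0 <= (1 : R) <= 1 by rewrite lexx ler01.
have B1 : cmod (trapezoid g N p u) <= M * cmod u.
  apply: trapezoid_bound => t tI; have := gM t 0 tI I0.
  by rewrite r2c0 mul0r addr0; apply; apply: Or43.
have B2 : cmod (trapezoid g N (p + u) v) <= M * cmod v.
  apply: trapezoid_bound => t tI; have := gM 1 t I1 tI.
  by rewrite r2c1 mul1r; apply; apply: Or42.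
have B3 : cmod (trapezoid g N (p + v) u) <= M * cmod u.
  apply: trapezoid_bound => t tI; have := gM t 1 tI I1.
  by rewrite r2c1 mul1r addrAC; apply; apply: Or44.
have B4 : cmod (trapezoid g N p v) <= M * cmod v.
  apply: trapezoid_bound => t tI; have := gM 0 t I0 tI.
  by rewrite r2c0 mul0r addr0; apply; apply: Or41.
rewrite /contour.
have := cmodB (trapezoid g N p u + trapezoid g N (p + u) v
   - trapezoid g N (p + v) u) (trapezoid g N p v).
have := cmodB (trapezoid g N p u + trapezoid g N (p + u) v)
   (trapezoid g N (p + v) u).
have := cmodD (trapezoid g N p u) (trapezoid g N (p + u) v).
lra.
Qed.

(** The intervals [s k, s k + 2^-k] are nested, as each step keeps a left or a right half. *)
Lemma dyadic_nested (s : nat -> R) :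
  (forall k, s k.+1 = s k \/ s k.+1 = s k + 2^-1 ^+ k.+1) ->
  exists x, forall k, s k <= x <= s k + 2^-1 ^+ k.
Proof.
move=> sS; have p0 k : 0 < 2^-1 ^+ k :> R by rewrite exprn_gt0.
have s_nd k : s k <= s k.+1 by case: (sS k) => ->//; rewrite lerDl ltW.
have s_ni k : s k.+1 + 2^-1 ^+ k.+1 <= s k + 2^-1 ^+ k.
  by have := p0 k; case: (sS k) => ->; rewrite exprS; lra.
have ndP k j : s k <= s (j + k)%N.
  by elim: j => [|j IH]//; apply: le_trans IH _; rewrite addSn.
have niP k j : s (j + k)%N + 2^-1 ^+ (j + k) <= s k + 2^-1 ^+ k.
  by elim: j => [|j IH]//; apply: le_trans IH; rewrite addSn.
have ub k : ubound (range s) (s k + 2^-1 ^+ k).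
  move=> _ [j _ <-]; have [jk|/ltnW kj] := leqP j k.
    by have := ndP j (k - j)%N; have := p0 k; rewrite subnK//; lra.
  by have := niP k (j - k)%N; have := p0 j; rewrite subnK//; lra.
exists (sup (range s)) => k; apply/andP; split.
  by apply: ub_le_sup; [exists (s 0%N + 2^-1 ^+ 0); exact: ub|exists k].
by apply: ge_sup; [exists (s 0%N); exists 0%N|exact: ub].
Qed.

Lemma half_pow_small (e : R) : 0 < e -> exists k, 2^-1 ^+ k < e.
Proof.
move=> e0; have [k kP] : exists k : nat, e^-1 < k%:R.
  by exists (Num.truncn e^-1).+1; exact: truncnS_gt.
exists k; rewrite exprVn -[e]invrK ltf_pV2 ?posrE ?invr_gt0 ?exprn_gt0//.
by apply: lt_trans kP _; rewrite -natrX ltr_nat ltn_expl.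
Qed.

(* Goursat's bisection: a bad square contains a nested sequence of bad squares, which
   shrinks to a point where g is almost affine. *)
Lemma contour_cvg0 (g : C -> C) (p u v : C) :
  (forall s t : R, 0 <= s <= 1 -> 0 <= t <= 1 -> cdiff g (p + r2c s * u + r2c t * v)) ->
  forall e : R, 0 < e ->
  exists N0, forall N, (N0 <= N)%N -> cmod (contour g N p u v) <= e.
Proof.
move=> gdiff e e0; apply: contrapT => bad0.
pose h k : R := 2^-1 ^+ k.
pose pt (st : R * R) := p + r2c st.1 * u + r2c st.2 * v.
(* The bound shrinks like the area, so that four good quarters make a good square. *)
pose bad k st := ~ exists N0, forall N, (N0 <= N)%N ->
  cmod (contour g N (pt st) (r2c (h k) * u) (r2c (h k) * v)) <= e * h k ^+ 2.
pose stp k (x y : R) := y = x \/ y = x + h k.+1.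
have step (ks : nat * (R * R)) : exists st' : R * R, bad ks.1 ks.2 ->
    [/\ stp ks.1 ks.2.1 st'.1, stp ks.1 ks.2.2 st'.2 & bad ks.1.+1 st'].
  case: ks => k [s t]; have [badk|] := pselect (bad k (s, t)); last by exists (s, t).
  have [H|] := pselect (exists st' : R * R,
    [/\ stp k s st'.1, stp k t st'.2 & bad k.+1 st']).
    by case: H => st' H; exists st'.
  move=> H; exfalso; apply: badk.
  have good s' t' : stp k s s' -> stp k t t' ->
      exists N0, forall N, (N0 <= N)%N ->
      cmod (contour g N (pt (s', t')) (r2c (h k.+1) * u) (r2c (h k.+1) * v))
        <= e * h k.+1 ^+ 2.
    by move=> ss' tt'; apply: contrapT => b; apply: H; exists (s', t').
  have [N1 H1] := good s t (or_introl erefl) (or_introl erefl).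
  have [N2 H2] := good _ t (or_intror erefl) (or_introl erefl).
  have [N3 H3] := good s _ (or_introl erefl) (or_intror erefl).
  have [N4 H4] := good _ _ (or_intror erefl) (or_intror erefl).
  (* The successor is the level spent by [contour_split]. *)
  exists (N1 + N2 + N3 + N4).+1 => -[//|N] NN.
  rewrite contour_split.
  have hE x : r2c (h k) * x / 2 = r2c (h k.+1) * x.
    by rewrite /h exprS !r2cE; ring.
  rewrite !hE.
  move: {H1}(H1 N) {H2}(H2 N) {H3}(H3 N) {H4}(H4 N).
  have -> : pt (s + h k.+1, t) = pt (s, t) + r2c (h k.+1) * u.
    by rewrite /pt /= !r2cE; ring.
  have -> : pt (s, t + h k.+1) = pt (s, t) + r2c (h k.+1) * v.
    by rewrite /pt /= !r2cE; ring.
  have -> : pt (s + h k.+1, t + h k.+1) =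
      pt (s, t) + r2c (h k.+1) * u + r2c (h k.+1) * v.
    by rewrite /pt /= !r2cE; ring.
  set c1 := contour _ _ _ _ _; set c2 := contour _ _ _ _ _.
  set c3 := contour _ _ _ _ _; set c4 := contour _ _ _ _ _.
  have L1 : (N1 <= N)%N by rewrite -ltnS (leq_ltn_trans _ NN)// -!addnA leq_addr.
  have L2 : (N2 <= N)%N.
    by rewrite -ltnS (leq_ltn_trans _ NN)// -!addnA addnCA leq_addr.
  have L3 : (N3 <= N)%N.
    by rewrite -ltnS (leq_ltn_trans _ NN)// addnAC leq_addl.
  have L4 : (N4 <= N)%N by rewrite -ltnS (leq_ltn_trans _ NN)// leq_addl.
  move=> /(_ L1) C1 /(_ L2) C2 /(_ L3) C3 /(_ L4) C4.
  have -> : h k ^+ 2 = 4 * h k.+1 ^+ 2 by rewrite /h [_ ^+ k.+1]exprS; field.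
  have := cmodD (c1 + c2 + c3) c4; have := cmodD (c1 + c2) c3.
  have := cmodD c1 c2; lra.
have [next nextP] := choice step.
pose sq := fix sq k := if k is k'.+1 then next (k', sq k') else (0, 0) : R * R.
have sqbad k : bad k (sq k).
  elim: k => [|k IH]; last by have [] := nextP (k, sq k) IH.
  move=> [N0 N0P]; apply: bad0; exists N0 => N /N0P.
  by rewrite /pt /h expr0 /= r2c0 r2c1 !mul0r !mul1r !addr0 expr1n mulr1.
have sqstp k : stp k (sq k).1 (sq k.+1).1 /\ stp k (sq k).2 (sq k.+1).2.
  by have [] := nextP (k, sq k) (sqbad k).
have [x xP] := dyadic_nested (fun k => (sqstp k).1).
have [y yP] := dyadic_nested (fun k => (sqstp k).2).
have I (z w : R) : z <= w <= z + 2^-1 ^+ 0 -> z = 0 -> 0 <= w <= 1.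
  by move=> zw z0; move: zw; rewrite z0 add0r expr0.
have [q [qz gE]] := gdiff x y (I _ _ (xP 0%N) erefl) (I _ _ (yP 0%N) erefl).
set z := p + r2c x * u + r2c y * v in q qz gE.
pose L := cmod u + cmod v; have L0 : 0 <= L by rewrite addr_ge0 ?cmod_ge0.
(* The error term will be at most 2 L^2 n times the square of [h k]. *)
pose n := e / (2 * L ^+ 2 + 1).
have D0 : 0 < 2 * L ^+ 2 + 1 by have := sqr_ge0 L; lra.
have n0 : 0 < n by rewrite divr_gt0.
have /rnorm_cont/(_ n n0)[r r0 rq] := qz.
have [k kP] : exists k, h k < r / (L + 1) by apply: half_pow_small; rewrite divr_gt0//; lra.
apply: (sqbad k); exists 0%N => N _.
have h0 : 0 < h k by rewrite exprn_gt0.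
(* The tangent map at the limit point has zero contour sums; what remains is (w - z) (q w - q z). *)
pose aff w := (g z - q z * z) + q z * w.
have -> : contour g N (pt (sq k)) (r2c (h k) * u) (r2c (h k) * v) =
    contour (fun w => g w - aff w) N (pt (sq k)) (r2c (h k) * u) (r2c (h k) * v).
  by rewrite contourB contour_affine subr0.
have : cmod (contour (fun w => g w - aff w) N (pt (sq k)) (r2c (h k) * u) (r2c (h k) * v))
    <= (h k * L * n) * (2 * (cmod (r2c (h k) * u) + cmod (r2c (h k) * v))).
  apply: contour_bound => s t /andP[s0 s1] /andP[t0 t1] _; set w := pt _ + _ + _.
  have -> : g w - aff w = (w - z) * (q w - q z).
    by rewrite /aff (gE w) /GRing.scale/=; ring.
  have wz : cmod (w - z) <= h k * L.
    have -> : w - z = r2c ((sq k).1 + s * h k - x) * u + r2c ((sq k).2 + t * h k - y) * v.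
      by rewrite /w /z /pt !r2cE; ring.
    apply: le_trans (cmodD _ _) _; rewrite !cmodM !cmod_r2c mulrDr.
    have := xP k; have := yP k; rewrite -/(h k) => /andP[y1 y2] /andP[x1 x2].
    have sh0 : 0 <= s * h k by rewrite mulr_ge0// ltW.
    have th0 : 0 <= t * h k by rewrite mulr_ge0// ltW.
    have sh1 : s * h k <= h k by rewrite ler_piMl// ltW.
    have th1 : t * h k <= h k by rewrite ler_piMl// ltW.
    by apply: lerD; apply: ler_wpM2r; rewrite ?cmod_ge0// ler_norml; apply/andP; split; lra.
  rewrite cmodM; apply: ler_pM; rewrite ?cmod_ge0//; apply/ltW/rq.
  apply: le_lt_trans wz _; apply: le_lt_trans (_ : h k * (L + 1) < r).
    by rewrite ler_wpM2l ?(ltW h0)//; lra.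
  by rewrite -ltr_pdivlMr//; lra.
move=> /le_trans; apply.
rewrite !cmodM !cmod_r2c gtr0_norm// -mulrDr -/L.
have -> : h k * L * n * (2 * (h k * L)) = (2 * L ^+ 2) * n * h k ^+ 2 by ring.
rewrite ler_wpM2r ?sqr_ge0// /n mulrCA ger_pMr// ler_pdivrMr// mul1r; lra.
Qed.

End Goursat.

(** * Maximum principle and Schwarz lemma *)

Section Schwarz.
Variable R : realType.
Local Notation C := (Cplx R).
Local Notation Re := (@complex.Re R).
Local Notation Im := (@complex.Im R).
Local Notation r2c := (@r2c R).

(* Applied to the powers of a function, a maximum principle with a constant K
   improves itself to one with constant 1. *)
Lemma exp_le_of_crude (x y K : R) : 0 <= x -> 0 <= y ->
  (forall n, x ^+ n <= K * y ^+ n) -> x <= y.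
Proof.
move=> x0 y0 H; rewrite leNgt; apply/negP => yx.
have xp : 0 < x by apply: le_lt_trans yx.
have [y00|yn0] := eqVneq y 0.
  by have := H 1%N; rewrite y00 expr0n/= mulr0 expr1 leNgt xp.
have yp : 0 < y by rewrite lt_def yn0.
pose r := x / y - 1; have r0 : 0 < r by rewrite subr_gt0 ltr_pdivlMr// mul1r.
have bern n : 1 + n%:R * r <= (1 + r) ^+ n.
  elim: n => [|n IH]; first by rewrite mul0r addr0 expr0.
  rewrite exprS; apply: le_trans (_ : (1 + r) * (1 + n%:R * r) <= _).
    rewrite -natr1; have : 0 <= r * (n%:R * r) by rewrite !mulr_ge0// ltW.
    lra.
  by rewrite ler_pM2l//; lra.
have Kb n : 1 + n%:R * r <= K.
  apply: le_trans (bern n) _; have -> : 1 + r = x / y by rewrite /r; lra.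
  by rewrite expr_div_n ler_pdivrMr ?exprn_gt0.
have := Kb (Num.truncn (K / r)).+1.
have := truncnS_gt (K / r); rewrite ltr_pdivrMr//; lra.
Qed.

Lemma Re_C (x y : R) : Re (Complex x y) = x. Proof. by []. Qed.
Lemma Im_C (x y : R) : Im (Complex x y) = y. Proof. by []. Qed.

(* The contour sums of (f z - f a)^2 / (z - a) tend to 0: unlike (f z - f a) / (z - a),
   this function is differentiable at a (with value 0 there, since 0^-1 = 0). *)
Lemma rect_crude (x1 x2 y1 y2 : R) (a : C) :
  x1 < Re a < x2 -> y1 < Im a < y2 ->
  exists K : R, forall (f : C -> C) (M : R), 0 <= M ->
    (forall z, x1 <= Re z <= x2 -> y1 <= Im z <= y2 -> cdiff f z) ->
    (forall z, x1 <= Re z <= x2 -> y1 <= Im z <= y2 ->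
       [\/ Re z = x1, Re z = x2, Im z = y1 | Im z = y2] -> cmod (f z) <= M) ->
    cmod (f a) <= K * M.
Proof.
move=> /andP[xa1 xa2] /andP[ya1 ya2].
pose p : C := Complex x1 y1; pose u := r2c (x2 - x1).
pose v : C := Complex 0 (y2 - y1).
have vR : Re v = 0 by []. have vI : Im v = y2 - y1 by [].
pose d := Num.min (Num.min (Re a - x1) (x2 - Re a)) (Num.min (Im a - y1) (y2 - Im a)).
have d0 : 0 < d by rewrite !lt_min !subr_gt0 xa1 xa2 ya1 ya2.
have [d1 d2 d3 d4] : [/\ d <= Re a - x1, d <= x2 - Re a, d <= Im a - y1 & d <= y2 - Im a].
  by split; rewrite /d !ge_min lexx ?orbT.
pose D := (x2 - x1) + (y2 - y1); have D0 : 0 < D by rewrite /D; lra.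
pose P := 2 * (cmod u + cmod v).
have P0 : 0 <= P by rewrite mulr_ge0// addr_ge0// cmod_ge0.
(* A lower bound for the imaginary part of the contour sums of 1 / (z - a): the bottom side alone
   gives this much, since |z - a| is at most [D], and the other sides contribute nonnegative
   amounts. *)
pose c := (x2 - x1) * (Im a - y1) / D ^+ 2.
have c0 : 0 < c by rewrite !mulr_gt0 ?invr_gt0 ?exprn_gt0// subr_gt0//; lra.
have ptE s t : p + r2c s * u + r2c t * v =
    Complex (x1 + s * (x2 - x1)) (y1 + t * (y2 - y1)).
  by rewrite /p /u /v /r2c; simpc; congr Complex; ring.
have ptI s t : 0 <= s <= 1 -> 0 <= t <= 1 ->
   (x1 <= x1 + s * (x2 - x1) <= x2) /\ (y1 <= y1 + t * (y2 - y1) <= y2).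
  move=> /andP[s0 s1] /andP[t0 t1].
  have w0 : 0 <= x2 - x1 by lra.
  have h0 : 0 <= y2 - y1 by lra.
  have := mulr_ge0 s0 w0; have := mulr_ge0 t0 h0.
  have := ler_piMl w0 s1; have := ler_piMl h0 t1.
  by move=> *; split; apply/andP; split; lra.
have pos3 (A B X : R) : 0 <= A -> 0 <= B -> 0 <= A / X ^+ 2 * B.
  by move=> A0 B0; rewrite mulr_ge0// divr_ge0// sqr_ge0.
pose k (z : C) := (z - a)^-1.
have zD z : x1 <= Re z <= x2 -> y1 <= Im z <= y2 -> cmod (z - a) <= D.
  move=> /andP[? ?] /andP[? ?]; apply: le_trans (cmod_le_ReIm _) _.
  by rewrite !ReImE; apply: lerD; rewrite ler_norml; apply/andP; split; lra.
have zd z : [\/ Re z = x1, Re z = x2, Im z = y1 | Im z = y2] -> d <= cmod (z - a).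
  have := Re_le_cmod (z - a); have := Im_le_cmod (z - a); rewrite !ReImE.
  rewrite !ler_norml => /andP[i1 i2] /andP[r1 r2].
  by case=> e; rewrite e in i1 i2 r1 r2; lra.
have kd z : [\/ Re z = x1, Re z = x2, Im z = y1 | Im z = y2] -> cmod (k z) <= d^-1.
  by move=> /zd dz; rewrite cmodV lef_pV2 ?posrE//; apply: lt_le_trans dz.
have kH z w : Im (k z * r2c w) = - (Im z - Im a) / cmod (z - a) ^+ 2 * w.
  by rewrite cImM cImV Im_r2c Re_r2c mulr0 add0r !ReImE.
have kV z : Im (k z * v) = (Re z - Re a) / cmod (z - a) ^+ 2 * (y2 - y1).
  by rewrite cImM cReV vR vI mulr0 addr0 !ReImE.
have I0 : 0 <= (0 : R) <= 1 by rewrite lexx ler01.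
have I1 : 0 <= (1 : R) <= 1 by rewrite lexx ler01.
have kc N : c <= Im (contour k N p u v).
  have T1 : c <= Im (trapezoid k N p u).
    apply: trapezoid_Im => t tI.
    have [X Y] := ptI t 0 tI I0; have := ptE t 0.
    rewrite r2c0 mul0r addr0 mul0r addr0 in Y *; move=> ->.
    rewrite kH /c.
    have zz := zd (Complex _ y1) (Or43 _ _ _ erefl).
    have := zD (Complex (x1 + t * (x2 - x1)) y1) X Y; have {zz} := zz (x1 + t * (x2 - x1)).
    set m := cmod _ => dm mD.
    have m0 : 0 < m by apply: lt_le_trans dm.
    rewrite opprB /= [leRHS]mulrAC [_ * (x2 - x1)]mulrC.
    rewrite ler_wpM2l//; first by apply: mulr_ge0; lra.
    by rewrite lef_pV2 ?posrE ?exprn_gt0// ler_pXn2r// nnegrE ltW.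
  have T2 : 0 <= Im (trapezoid k N (p + u) v).
    apply: trapezoid_Im => t tI; have := ptE 1 t; rewrite r2c1 mul1r => ->.
    by rewrite kV; apply: pos3; rewrite ?Re_C; lra.
  have T3 : 0 <= Im (trapezoid (fun z => -1 * k z) N (p + v) u).
    apply: trapezoid_Im => t tI; have := ptE t 1; rewrite r2c1 mul1r addrAC => ->.
    rewrite mulN1r mulNr cImN kH mulNr mulNr opprK.
    by apply: pos3; rewrite ?Im_C; lra.
  have T4 : 0 <= Im (trapezoid (fun z => -1 * k z) N p v).
    apply: trapezoid_Im => t tI; have := ptE 0 t; rewrite r2c0 mul0r addr0 => ->.
    rewrite mulN1r mulNr cImN kV -!mulNr.
    by apply: pos3; rewrite ?Re_C; lra.
  move: T3 T4; rewrite !trapezoidZ !mulN1r /contour !ReImE; lra.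
(* The summand 1 serves when |f a| is at most M. Otherwise [key] bounds |f a|^2 c by 3 |f a| M P /
   d. *)
exists (1 + 3 * P / (d * c)) => f M M0 fd fM.
pose m := cmod (f a); have m0 : 0 <= m by exact: cmod_ge0.
pose G z := (f z - f a) ^+ 2 * k z.
have Gd s t : 0 <= s <= 1 -> 0 <= t <= 1 -> cdiff G (p + r2c s * u + r2c t * v).
  move=> sI tI; have [X Y] := ptI s t sI tI; rewrite ptE; move: X Y.
  set z : C := Complex _ _; move=> X Y; have fz := fd z X Y.
  have [za|za] := eqVneq z a.
    move: fz; rewrite za => -[q [qz fE]].
    exists (fun w => q w ^+ 2); split.
      exact: (@continuousM _ _ q q a qz qz).
    move=> w; rewrite /G /k subrr expr0n/= mul0r add0r.
    rewrite (fE w) [f a + _]addrC addrK /GRing.scale/=.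
    have [->|wa] := eqVneq w a; first by rewrite subrr !mul0r expr0n/= mul0r.
    by field; rewrite subr_eq0.
  apply: cdiffM; first by apply: cdiffX; apply: cdiffB => //; exact: cdiff_cst.
  apply: (@cdiffV R (fun w => w - a)); first by rewrite subr_eq0.
  by apply: cdiffB; [exact: cdiff_id|exact: cdiff_cst].
have key e : 0 < e -> m ^+ 2 * c <= e + (M ^+ 2 + 2 * m * M) * (P / d).
  move=> e0; have [N /(_ N (leqnn N)) GN] := contour_cvg0 Gd e0.
  have B1 : cmod (contour (fun z => f z ^+ 2 * k z) N p u v) <= (M ^+ 2 / d) * P.
    apply: contour_bound => s t sI tI; rewrite ptE => st.
    have [X Y] := ptI s t sI tI; set z : C := Complex _ _.
    have zb : [\/ Re z = x1, Re z = x2, Im z = y1 | Im z = y2].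
      rewrite /z Re_C Im_C.
      by case: st => ->; [apply: Or41|apply: Or42|apply: Or43|apply: Or44]; ring.
    rewrite cmodM cmodX; apply: ler_pM; rewrite ?exprn_ge0 ?cmod_ge0//; last exact: kd.
    by rewrite ler_pXn2r ?nnegrE ?cmod_ge0//; exact: fM.
  have B2 : cmod (contour (fun z => f z * k z) N p u v) <= (M / d) * P.
    apply: contour_bound => s t sI tI; rewrite ptE => st.
    have [X Y] := ptI s t sI tI; set z : C := Complex _ _.
    have zb : [\/ Re z = x1, Re z = x2, Im z = y1 | Im z = y2].
      rewrite /z Re_C Im_C.
      by case: st => ->; [apply: Or41|apply: Or42|apply: Or43|apply: Or44]; ring.
    by rewrite cmodM; apply: ler_pM; rewrite ?cmod_ge0//; [exact: fM|exact: kd].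
  have GE : contour G N p u v = contour (fun z => f z ^+ 2 * k z) N p u v
      - (2 * f a) * contour (fun z => f z * k z) N p u v + f a ^+ 2 * contour k N p u v.
    pose A z := f z ^+ 2 * k z; pose B z := f z * k z.
    have -> : G = (fun z => (A z - 2 * f a * B z) - (- f a ^+ 2) * k z).
      by apply/funext => z; rewrite /G /A /B; ring.
    rewrite (contourB (fun z => A z - 2 * f a * B z) (fun z => - f a ^+ 2 * k z)).
    by rewrite (contourB A (fun z => 2 * f a * B z)) !contourZ mulNr opprK.
  move: GE GN B1 B2; set g := contour G _ _ _ _; set g1 := contour _ _ _ _ _.
  set g2 := contour _ _ _ _ _; set g3 := contour _ _ _ _ _ => GE GN B1 B2.
  have E : f a ^+ 2 * g3 = g - g1 + 2 * f a * g2 by rewrite GE; ring.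
  have L : m ^+ 2 * c <= cmod (f a ^+ 2 * g3).
    rewrite cmodM cmodX ler_wpM2l ?exprn_ge0//; apply: le_trans (kc N) _.
    by apply: le_trans (Im_le_cmod _); exact: ler_norm.
  apply: le_trans L _; rewrite E; apply: le_trans (cmodD _ _) _.
  have -> : e + (M ^+ 2 + 2 * m * M) * (P / d) =
     e + M ^+ 2 / d * P + 2 * m * (M / d * P) by ring.
  apply: lerD; first by apply: le_trans (cmodB _ _) _; exact: lerD.
  rewrite !cmodM -/m -r2cn cmod_r2c normr_nat ler_wpM2l// mulr_ge0//.
have {}key : m ^+ 2 * c <= (M ^+ 2 + 2 * m * M) * (P / d).
  by apply/ler_addgt0Pl => e e0; exact: key.
have Pd0 : 0 <= P / d by rewrite divr_ge0// ltW.
have K0 : 0 <= 3 * P / (d * c).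
  by apply: divr_ge0; apply: mulr_ge0 => //; exact: ltW.
rewrite mulrDl mul1r -/m; have [mM|Mm] := leP m M.
  by rewrite -[m]addr0 lerD// mulr_ge0.
have mp : 0 < m by apply: le_lt_trans Mm.
have : m ^+ 2 * c <= m * (3 * M * (P / d)).
  apply: le_trans key _; rewrite [leRHS]mulrA ler_wpM2r//.
  have : M * M <= m * M by rewrite ler_wpM2r// ltW.
  by rewrite expr2; lra.
rewrite expr2 -mulrA ler_pM2l// => H.
have : m <= 3 * M * (P / d) / c by rewrite ler_pdivlMr.
have -> : 3 * M * (P / d) / c = 3 * P / (d * c) * M by field; rewrite !gt_eqF.
lra.
Qed.

(** The constant of [rect_crude] does not depend on [f], hence it serves all powers of [f] at
    once. *)
Lemma rect_max (x1 x2 y1 y2 : R) (a : C) (f : C -> C) (M : R) :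
  x1 < Re a < x2 -> y1 < Im a < y2 -> 0 <= M ->
  (forall z, x1 <= Re z <= x2 -> y1 <= Im z <= y2 -> cdiff f z) ->
  (forall z, x1 <= Re z <= x2 -> y1 <= Im z <= y2 ->
     [\/ Re z = x1, Re z = x2, Im z = y1 | Im z = y2] -> cmod (f z) <= M) ->
  cmod (f a) <= M.
Proof.
move=> xa ya M0 fd fM; have [K KP] := rect_crude xa ya.
apply: (@exp_le_of_crude _ _ K) => // [|n]; first exact: cmod_ge0.
rewrite -cmodX; apply: (KP (fun z => f z ^+ n)) => [|z X Y|z X Y B].
- exact: exprn_ge0.
- by apply: cdiffX; exact: fd.
- by rewrite cmodX; apply: lerXn2r; rewrite ?nnegrE ?cmod_ge0//; exact: fM.
Qed.

Lemma cdiff_mobius (a b c d z : C) : c * z + d != 0 ->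
  cdiff (fun w => (a * w + b) / (c * w + d)) z.
Proof.
move=> cd0; have lin (x y : C) : cdiff (fun w => x * w + y) z.
  apply: cdiffD; last exact: cdiff_cst.
  by apply: cdiffM; [exact: cdiff_cst|exact: cdiff_id].
by apply: cdiffM => //; exact: (@cdiffV R (fun w => c * w + d)).
Qed.

Lemma continuousX (q : C -> C) (z : C) n :
  {for z, continuous q} -> {for z, continuous (fun w => q w ^+ n)}.
Proof.
move=> qz; elim: n => [|n IH].
  have -> : (fun w => q w ^+ 0) = (fun=> 1) by apply/funext => w; rewrite expr0.
  exact: cst_continuous.
have -> : (fun w => q w ^+ n.+1) = (fun w => q w * q w ^+ n).
  by apply/funext => w; rewrite exprS.
exact: (@continuousM _ _ q (fun w => q w ^+ n) z qz IH).
Qed.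

(** Measures how close to the unit circle the Cayley transform sends the boundary of the rectangle
    in [schwarz]. *)
Lemma cmod_cayley (w : C) : 0 < Re w ->
  cmod ((w - 1) / (w + 1)) ^+ 2 = 1 - 4 * Re w / cmod (w + 1) ^+ 2.
Proof.
move=> w0; rewrite cmodM cmodV expr_div_n.
have n0 : cmod (w + 1) ^+ 2 != 0.
  rewrite expf_neq0// cmod_eq0; apply/eqP => /(congr1 Re).
  by rewrite cReD -r2c1 Re_r2c -r2c0 Re_r2c; lra.
apply: (mulIf n0); rewrite divfK// mulrBl divfK// !cmod_sqr -r2c1 !ReImE; ring.
Qed.

(* Maximum principle for phi^(n+1) / z^n, transported by the Cayley transform to the
   rectangle [e, 1/e] x [-1/e, 1/e] of the right half-plane; then n goes to infinity. *)
Lemma schwarz (phi : C -> C) :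
  (forall z, cmod z < 1 -> cdiff phi z) ->
  (forall z, cmod z < 1 -> cmod (phi z) <= 1) -> phi 0 = 0 ->
  forall t, cmod t < 1 -> cmod (phi t) <= cmod t.
Proof.
move=> phid phi1 phi0 t t1; set x := cmod (phi t); set y := cmod t.
have [x0|x0] := leP x 0; first by apply: le_trans x0 (cmod_ge0 _).
have y0 : 0 < y.
  by rewrite cmod_gt0; apply: contraTneq x0 => t0; rewrite /x t0 phi0 cmod0 ltxx.
have tn1 : 1 - t != 0.
  by rewrite subr_eq0; apply: contraTneq t1 => <-; rewrite cmod1 ltxx.
pose a := (1 + t) / (1 - t).
have Ra : 0 < Re a.
  rewrite cReM cReV cImV -r2c1 !ReImE r2c1.
  set D := cmod _; have D0 : 0 < D by rewrite cmod_gt0.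
  have : y ^+ 2 < 1 by rewrite expr_lt1 ?cmod_ge0.
  rewrite /y cmod_sqr => yy.
  have -> : (1 + Re t) * ((1 - Re t) / D ^+ 2) - (0 + Im t) * (- (0 - Im t) / D ^+ 2)
     = (1 - (Re t ^+ 2 + Im t ^+ 2)) / D ^+ 2 by ring.
  by rewrite divr_gt0 ?exprn_gt0// subr_gt0.
have ca : (a - 1) / (a + 1) = t.
  rewrite /a; field; rewrite tn1 /=.
  have -> : 1 + t + (1 - t) = 2 by ring.
  by rewrite pnatr_eq0.
have main e : 0 < e -> e < 4^-1 -> e < Re a -> Re a < e^-1 -> `|Im a| < e^-1 ->
    x * (1 - 4 * e) <= y.
  move=> e0 e4 ea1 ea2; rewrite ltr_norml => ea3.
  have s0 : 0 < 1 - 4 * e by lra.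
  apply: (@exp_le_of_crude _ _ x^-1); [by rewrite ltW// mulr_gt0|exact: ltW|].
  (* The extra power in the numerator makes [G] vanish at 0, in agreement with the default value of
     the quotient there. *)
  move=> n; pose G z := phi z ^+ n.+1 / z ^+ n.
  have Gd z : cmod z < 1 -> cdiff G z.
    move=> z1; have [z0|z0] := eqVneq z 0.
      have := phid z z1; rewrite z0 => -[q [qz qE]].
      exists (fun w => q w ^+ n.+1); split; first exact: continuousX.
      have G0 w : G w = q w ^+ n.+1 * w.
        rewrite /G qE phi0 add0r subr0 /GRing.scale/=.
        have [->|w0] := eqVneq w 0; first by rewrite !mul0r expr0n/= mul0r mulr0.
        by rewrite exprMn exprS; field; rewrite expf_neq0.
      by move=> w; rewrite !G0 mulr0 add0r subr0 mulrC.
    apply: cdiffM; first by apply: cdiffX; exact: phid.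
    apply: (@cdiffV R (fun w => w ^+ n)); first by rewrite expf_neq0.
    by apply: cdiffX; exact: cdiff_id.
  have wP (w : C) : 0 < Re w -> cmod ((w - 1) / (w + 1)) < 1.
    move=> w0; rewrite -(@ltr_pXn2r _ 2) ?nnegrE ?cmod_ge0 ?ler01// expr1n.
    rewrite cmod_cayley// ltrBlDr ltrDl; apply: divr_gt0; first exact: mulr_gt0.
    rewrite exprn_gt0// cmod_gt0.
    apply/eqP => /(congr1 Re).
    by rewrite cReD -r2c1 Re_r2c -r2c0 Re_r2c; lra.
  have w1 (w : C) : 0 < Re w -> 1 * w + 1 != 0.
    move=> w0; rewrite mul1r; apply/eqP => /(congr1 Re).
    by rewrite cReD -r2c1 Re_r2c -r2c0 Re_r2c; lra.
  have : cmod (G ((a - 1) / (a + 1))) <= ((1 - 4 * e) ^+ n)^-1.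
    apply: (@rect_max e e^-1 (- e^-1) e^-1 a (fun w => G ((w - 1) / (w + 1)))).
    - by apply/andP.
    - exact: ea3.
    - by rewrite invr_ge0 exprn_ge0// ltW.
    - move=> w /andP[we _] _; have w0 : 0 < Re w by apply: lt_le_trans we.
      apply: (@cdiff_comp R _ G (fun w => (w - 1) / (w + 1))); last exact/Gd/wP.
      have -> : (fun w : C => (w - 1) / (w + 1)) = (fun w => (1 * w + - 1) / (1 * w + 1)).
        by apply/funext => v; rewrite !mul1r.
      exact/cdiff_mobius/w1.
    - move=> w /andP[we we'] _ wb; have w0 : 0 < Re w by apply: lt_le_trans we.
      set c := (w - 1) / (w + 1).
      have c1 : cmod c < 1 by exact: wP.
      have c2 : 1 - 4 * e <= cmod c ^+ 2.
        have w10 : 0 < cmod (w + 1) ^+ 2.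
          by rewrite exprn_gt0// cmod_gt0 -[w]mul1r w1.
        rewrite cmod_cayley// lerD2l lerN2 ler_pdivrMr// cmod_sqr -r2c1 !ReImE addr0.
        have ei : e * e^-1 = 1 by rewrite divff// gt_eqF.
        have i0 : 0 < e^-1 by rewrite invr_gt0.
        (* On the side Re w = e because |w + 1| is at least 1; on the other three because Re w is at
           most 1/e and |w + 1| at least 1/e. *)
        have : Re w <= e * ((Re w + 1) ^+ 2 + Im w ^+ 2); last by lra.
        have b1 : 1 <= (Re w + 1) ^+ 2 by rewrite expr_ge1 ?lerDr//; lra.
        have b2 : 0 <= Im w ^+ 2 by rewrite sqr_ge0.
        case: wb => wE.
        * by rewrite {1}wE -[X in X <= _]mulr1 ler_wpM2l ?(ltW e0)//; lra.
        * have : Re w ^+ 2 <= (Re w + 1) ^+ 2 by rewrite lerXn2r ?nnegrE//; lra.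
          move=> b3; apply: le_trans (_ : e * Re w ^+ 2 <= _).
            by rewrite wE expr2 mulrA ei mul1r.
          by rewrite ler_wpM2l ?(ltW e0)//; lra.
        * apply: le_trans (_ : e * Im w ^+ 2 <= _).
            by rewrite wE sqrrN expr2 mulrA ei mul1r.
          by rewrite ler_wpM2l ?(ltW e0)//; lra.
        * apply: le_trans (_ : e * Im w ^+ 2 <= _).
            by rewrite wE expr2 mulrA ei mul1r.
          by rewrite ler_wpM2l ?(ltW e0)//; lra.
      have c3 : 1 - 4 * e <= cmod c.
        by apply: le_trans c2 _; rewrite expr2 ler_piMr ?cmod_ge0// ltW.
      have c0 : 0 < cmod c by apply: lt_le_trans c3.
      rewrite /G cmodM cmodV !cmodX -[leRHS]mul1r; apply: ler_pM.
      + by rewrite exprn_ge0// cmod_ge0.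
      + by rewrite invr_ge0 exprn_ge0// cmod_ge0.
      + by rewrite exprn_ile1 ?cmod_ge0// phi1.
      + by rewrite lef_pV2 ?posrE ?exprn_gt0// lerXn2r ?nnegrE// ltW.
  rewrite ca /G cmodM cmodV !cmodX -/x -/y => H.
  rewrite ler_pdivlMl//.
  rewrite ler_pdivrMr ?exprn_gt0// ler_pdivlMl ?exprn_gt0// in H.
  by apply: le_trans H; rewrite exprMn exprS mulrA [leRHS]mulrC.
rewrite leNgt; apply/negP => yx.
(* The last term makes 4 e x at most (x - y) / 2, which contradicts [main]; the others put [a]
   inside the rectangle. *)
pose e := Num.min (Num.min (8^-1) (Re a / 2))
  (Num.min (Num.min ((Re a + 1)^-1) ((`|Im a| + 1)^-1)) ((x - y) / (8 * x))).
have Im0 : 0 <= `|Im a| by rewrite normr_ge0.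
have e0 : 0 < e.
  have A : 0 < (Re a + 1)^-1 by rewrite invr_gt0; lra.
  have B : 0 < (`|Im a| + 1)^-1 by rewrite invr_gt0; lra.
  have D : 0 < (x - y) / (8 * x) by rewrite divr_gt0 ?mulr_gt0 ?subr_gt0.
  have E : 0 < 8^-1 :> R by rewrite invr_gt0.
  have F : 0 < Re a / 2 by rewrite divr_gt0.
  by rewrite !lt_min A B D E F.
have [e1 e2 e3 e4 e5] : [/\ e <= 8^-1, e <= Re a / 2, e <= (Re a + 1)^-1,
    e <= (`|Im a| + 1)^-1 & e <= (x - y) / (8 * x)].
  by split; rewrite /e !ge_min lexx ?orbT.
have : x * (1 - 4 * e) <= y.
  apply: main => //; [lra|lra| |].
    by rewrite -[Re a]invrK ltf_pV2 ?posrE ?invr_gt0//; apply: le_lt_trans e3 _; rewrite ltf_pV2 ?posrE//; lra.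
  apply: lt_le_trans (_ : `|Im a| + 1 <= _); first by lra.
  by rewrite -[_ + 1]invrK lef_pV2 ?posrE ?invr_gt0//; lra.
move: e5; rewrite ler_pdivlMr ?mulr_gt0//; lra.
Qed.

(** Apply [schwarz] to (g - g 0) / (g + conj (g 0)), where the quotient sends the half-plane Re < 0
    to the disk and g 0 to 0, and solve for |g t - g 0|. A small shift covers Re <= 0. *)
Lemma schwarz_halfplane (g : C -> C) :
  (forall z, cmod z < 1 -> cdiff g z) ->
  (forall z, cmod z < 1 -> Re (g z) <= 0) ->
  forall t, cmod t < 1 ->
  cmod (g t - g 0) <= 2 * cmod t / (1 - cmod t) * (- Re (g 0)).
Proof.
move=> gd; have strict (h : C -> C) : (forall z, cmod z < 1 -> cdiff h z) ->
    (forall z, cmod z < 1 -> Re (h z) < 0) -> forall t, cmod t < 1 ->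
    cmod (h t - h 0) <= 2 * cmod t / (1 - cmod t) * (- Re (h 0)).
  move=> hd h0 t t1; have i0 : cmod (0 : C) < 1 by rewrite cmod0 ltr01.
  have [c cR cI] : exists2 c : C, Re c = Re (h 0) & Im c = - Im (h 0).
    by exists (Complex (Re (h 0)) (- Im (h 0))).
  have hc0 z : cmod z < 1 -> h z + c != 0.
    move=> z1; apply/eqP => /(congr1 Re); rewrite cReD -r2c0 Re_r2c cR.
    by have := h0 _ z1; have := h0 _ i0; lra.
  have : cmod ((h t - h 0) / (h t + c)) <= cmod t.
    apply: (@schwarz (fun z => (h z - h 0) / (h z + c))) => //.
    - move=> z z1; apply: cdiffM.
        by apply: cdiffB; [exact: hd|exact: cdiff_cst].
      apply: (@cdiffV R (fun z => h z + c)); first exact: hc0.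
      by apply: cdiffD; [exact: hd|exact: cdiff_cst].
    - move=> z z1; rewrite cmodM cmodV ler_pdivrMr ?cmod_gt0 ?hc0// mul1r.
      rewrite -(@ler_pXn2r _ 2) ?nnegrE ?cmod_ge0// !cmod_sqr !ReImE cR cI.
      have : 0 <= Re (h z) * Re (h 0) by rewrite mulr_le0//; apply/ltW/h0.
      rewrite !expr2; lra.
    - by rewrite subrr mul0r.
  rewrite cmodM cmodV ler_pdivrMr ?cmod_gt0 ?hc0//.
  have -> : h t + c = (h t - h 0) + r2c (2 * Re (h 0)).
    by apply/eqP; rewrite eq_complex !ReImE cR cI; apply/andP; split; apply/eqP; ring.
  set u := h t - h 0 => H.
  have H2 : cmod u <= cmod t * (cmod u + 2 * - Re (h 0)).
    apply: le_trans H _; rewrite ler_wpM2l ?cmod_ge0//; apply: le_trans (cmodD _ _) _.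
    by rewrite cmod_r2c ltr0_norm -?mulrN//; have := h0 _ i0; lra.
  rewrite mulrAC ler_pdivlMr ?subr_gt0//; move: H2; lra.
move=> g0 t t1; set K := 2 * _ / _.
have K0 : 0 <= K by rewrite /K divr_ge0 ?mulr_ge0 ?cmod_ge0// subr_ge0 ltW.
apply/ler_addgt0Pr => e e0; pose n := e / (K + 1).
have n0 : 0 < n by rewrite divr_gt0//; lra.
apply: le_trans (_ : K * (- Re (g 0 - r2c n)) <= _).
  have -> : g t - g 0 = g t - r2c n - (g 0 - r2c n) by ring.
  apply: (strict (fun z => g z - r2c n)) => // z z1.
    by apply: cdiffB; [exact: gd|exact: cdiff_cst].
  by rewrite !ReImE; have := g0 _ z1; lra.
rewrite !ReImE opprB mulrBr mulrN [leLHS]addrC lerD2l.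
by rewrite /n mulrCA ger_pMr// ler_pdivrMr; lra.
Qed.

End Schwarz.

(** * The Kobayashi distance *)

Section Kobayashi.
Variables (R : realType) (d : nat).
Local Notation C := (Cplx R).
Local Notation Re := (@complex.Re R).
Local Notation Im := (@complex.Im R).
Local Notation r2c := (@r2c R).
Local Notation V := (Cd R d).
Implicit Types (O : set V) (x y : V).

Definition hol_into (O : set V) (f : C -> V) : Prop :=
  forall z : C, cmod z < 1 -> cdiff f z /\ O (f z).

Lemma hol_intoP O f : hol_into O f <->
  holomorphic_on (unit_disk R) f /\ f @` unit_disk R `<=` O.
Proof.
split=> [H|[fd fO] z z1].
  split=> [z /H[fz _]|_ [z /H[_ fz] <-]//]; exact/cdiff_derivable.
by split; [exact/cdiff_derivable/fd|apply: fO; exists z].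
Qed.

Lemma kob_chain0 O x : kob_chain O x x 0.
Proof.
by exists 0%N, (fun=> x), (fun=> 0), (fun=> fun=> x); split => //; rewrite big_ord0.
Qed.

Lemma kob_chain_disc0 O f (t : C) : hol_into O f -> cmod t < 1 ->
  kob_chain O (f 0) (f t) (poincare0 t).
Proof.
move=> /hol_intoP[fd fO] t1.
exists 1%N, (fun i => if i is 0%N then f 0 else f t), (fun=> t), (fun=> f).
by split => // [[]//|]; rewrite big_ord1.
Qed.

Lemma kob_chain_cat O x y (z : V) s r :
  kob_chain O x y s -> kob_chain O y z r -> kob_chain O x z (s + r).
Proof.
move=> [n [p [t [f [p0 pn H ->]]]]] [m [p' [t' [f' [p0' pm' H' ->]]]]].
exists (n + m)%N, (fun i => if (i < n)%N then p i else p' (i - n)%N),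
  (fun i => if (i < n)%N then t i else t' (i - n)%N),
  (fun i => if (i < n)%N then f i else f' (i - n)%N); split.
- case: ltnP => // n0; have n00 : n = 0%N by apply/eqP; rewrite -leqn0.
  by rewrite n00 subn0 p0' -pn n00 p0.
- by rewrite ltnNge leq_addr/= addKn.
- move=> i inm; case: ltnP => ni; last first.
    rewrite [(i.+1 < n)%N]ltnNge leqW//= subSn//; apply: H'.
    by rewrite ltn_subLR.
  have [a1 a2 a3 a4 a5] := H i ni; split => //.
  by case: ltnP => // ni'; have <- : i.+1 = n by [apply/eqP; rewrite eqn_leq ni];
    rewrite subnn p0' -pn a5; congr p; apply/eqP; rewrite eqn_leq ni.
- rewrite big_split_ord/=; congr (_ + _); apply: eq_bigr => i _.
    by rewrite ltn_ord.
  by rewrite ltnNge leq_addr/= addKn.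
Qed.

(** Induction that peels off the first disk; later estimates and constructions on chains are reduced
    to a single disk by it. *)
Lemma kob_chain_rec O (P : V -> V -> R -> Prop) :
  (forall x, P x x 0) ->
  (forall y s f (t : C), hol_into O f -> cmod t < 1 ->
     P (f t) y s -> P (f 0) y (poincare0 t + s)) ->
  forall x y s, kob_chain O x y s -> P x y s.
Proof.
move=> P0 PS x y s [n [p [t [f [p0 pn H ->]]]]]; move: p0 pn H.
elim: n x p t f => [|n IH] x p t f p0 pn H.
  by rewrite big_ord0 -p0 -pn; exact: P0.
have [h1 h2 h3 h4 h5] := H 0%N isT.
rewrite big_ord_recl/= -p0 -h4; apply: PS => //; first exact/hol_intoP.
rewrite h5.
exact: (IH _ (fun i => p i.+1) (fun i => t i.+1) (fun i => f i.+1) erefl pn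
  (fun i ni => H i.+1 ni)).
Qed.

(** The automorphism of the unit disk that sends 0 to [a]; its inverse is [mob (- a)]. *)
Definition mob (a z : C) : C := (z + a) / (conjc a * z + 1).

Lemma mob_den (a z : C) : cmod a < 1 -> cmod z < 1 -> conjc a * z + 1 != 0.
Proof.
move=> a1 z1; rewrite addr_eq0; apply/eqP => e.
have := congr1 (@cmod R) e; rewrite cmodM cmodN cmod1.
have -> : cmod (conjc a : C) = cmod a by rewrite /cmod normcJ.
by move=> h; have := mulr_ilt1 (cmod_ge0 a) (cmod_ge0 z) a1 z1; rewrite h ltxx.
Qed.

Lemma mob_lt1 (a z : C) : cmod a < 1 -> cmod z < 1 -> cmod (mob a z) < 1.
Proof.
move=> a1 z1; have d0 := mob_den a1 z1.
rewrite cmodM cmodV ltr_pdivrMr ?cmod_gt0// mul1r.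
rewrite -(@ltr_pXn2r _ 2) ?nnegrE ?cmod_ge0// !cmod_sqr.
have : 0 < (1 - cmod z ^+ 2) * (1 - cmod a ^+ 2).
  by rewrite mulr_gt0// subr_gt0 expr_lt1 ?cmod_ge0.
rewrite !cmod_sqr; case: a z {a1 z1 d0} => [p q] [r s] => H.
rewrite -subr_gt0; congr (0 < _): H => /=; ring.
Qed.

Lemma mobK (a z : C) : cmod a < 1 -> cmod z < 1 -> mob a (mob (- a) z) = z.
Proof.
move=> a1 z1; have a1' : cmod (- a) < 1 by rewrite cmodN.
have h1 := mob_den a1' z1; have h2 := mob_den a1 (mob_lt1 a1' z1).
move: h1 h2; rewrite /mob rmorphN/=; set b := conjc a => h1 h2.
have h3 : 1 - b * a != 0.
  apply: contra_neq h2 => e.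
  have -> : b * ((z - a) / (- b * z + 1)) + 1 = (1 - b * a) / (- b * z + 1) by field.
  by rewrite e mul0r.
field; rewrite h1 /=; have -> : b * (z - a) + (- b * z + 1) = 1 - b * a by ring.
exact: h3.
Qed.

Lemma mob0 (a : C) : mob a 0 = a.
Proof. by rewrite /mob mulr0 !add0r divr1. Qed.

Lemma hol_into_mob O f (a : C) : cmod a < 1 -> hol_into O f ->
  hol_into O (fun z => f (mob a z)).
Proof.
move=> a1 fO z z1; have [fz Oz] := fO _ (mob_lt1 a1 z1); split => //.
apply: (@cdiff_comp R _ f (mob a)) => //.
have -> : mob a = (fun w => (1 * w + a) / (conjc a * w + 1)).
  by apply/funext => w; rewrite mul1r.
exact/cdiff_mobius/mob_den.
Qed.

(** Chains only join the centre of a disk to another point; recentring by [mob] reaches any two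
    points. *)
Lemma kob_chain_disc O f (a b : C) : hol_into O f -> cmod a < 1 -> cmod b < 1 ->
  kob_chain O (f a) (f b) (poincare0 (mob (- a) b)).
Proof.
move=> fO a1 b1; have a1' : cmod (- a) < 1 by rewrite cmodN.
have := kob_chain_disc0 (hol_into_mob a1 fO) (mob_lt1 a1' b1).
by rewrite mobK// mob0.
Qed.

Lemma poincare0_exp (t : C) (r : R) : cmod t < 1 ->
  (poincare0 t = r) <-> (1 + cmod t) / (1 - cmod t) = expR (2 * r).
Proof.
move=> t1; have D0 : 0 < (1 + cmod t) / (1 - cmod t).
  by rewrite divr_gt0 ?subr_gt0// ltr_pwDl ?cmod_ge0.
rewrite /poincare0; split => [<-|->].
  by rewrite mulrA divff ?pnatr_eq0// mul1r lnK.
by rewrite expRK mulrA mulVf ?pnatr_eq0// mul1r.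
Qed.

Lemma poincare0_ge0 (t : C) : cmod t < 1 -> 0 <= poincare0 t.
Proof.
move=> t1; rewrite mulr_ge0 ?invr_ge0// ln_ge0// ler_pdivlMr ?subr_gt0//.
by have := cmod_ge0 t; lra.
Qed.

Lemma poincare0N (t : C) : poincare0 (- t) = poincare0 t.
Proof. by rewrite /poincare0 cmodN. Qed.

Lemma kob_chain_sym O x y s : kob_chain O x y s -> kob_chain O y x s.
Proof.
move: x y s; apply: kob_chain_rec => [x|y s f t fO t1 H]; first exact: kob_chain0.
rewrite addrC; apply: kob_chain_cat H _.
have c0 : cmod (0 : C) < 1 by rewrite cmod0.
have := kob_chain_disc fO t1 c0; suff -> : mob (- t) 0 = - t by rewrite poincare0N.
exact: mob0.
Qed.

Lemma kob_chain_ge0 O x y s : kob_chain O x y s -> 0 <= s.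
Proof.
move: x y s; apply: kob_chain_rec => // y s f t _ t1 s0.
by rewrite addr_ge0// poincare0_ge0.
Qed.

Lemma kob_le O x y s : kob_chain O x y s -> kobayashi O x y <= s.
Proof.
move=> H; apply: ge_inf => //; exists 0 => r; exact: kob_chain_ge0.
Qed.

Lemma kob_sym O x y : kobayashi O x y = kobayashi O y x.
Proof.
by congr inf; apply/seteqP; split => s; exact: kob_chain_sym.
Qed.

Lemma kob_xx O x : kobayashi O x x = 0.
Proof.
apply/eqP; rewrite eq_le kob_le//=; last exact: kob_chain0.
apply: lb_le_inf; first by exists 0; exact: kob_chain0.
by move=> s; exact: kob_chain_ge0.
Qed.

Lemma kob_disc O f (a b : C) : hol_into O f -> cmod a < 1 -> cmod b < 1 ->
  kobayashi O (f a) (f b) <= poincare0 (mob (- a) b).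
Proof. by move=> *; apply/kob_le/kob_chain_disc. Qed.

Lemma kob_disc0 O f (t : C) : hol_into O f -> cmod t < 1 ->
  kobayashi O (f 0) (f t) <= poincare0 t.
Proof. by move=> *; apply/kob_le/kob_chain_disc0. Qed.

(** The disk is x + (z / t) (y - x). A prescribed [t], rather than |y - x| / r, gives a uniform cost
    and admits y = x. *)
Lemma kob_chain_ball O x y (r t : R) :
  0 < r -> (forall z, rnorm (z - x) < r -> O z) -> 0 < t < 1 -> rnorm (y - x) <= r * t ->
  kob_chain O x y (poincare0 (r2c t)).
Proof.
move=> r0 xO /andP[t0 t1] yx.
pose f (z : C) := x + (z / r2c t) *: (y - x).
have tn0 : r2c t != 0 by rewrite -cmod_eq0 cmod_r2c normr_eq0 gt_eqF.
have f0 : f 0 = x by rewrite /f mul0r scale0r addr0.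
have ft : f (r2c t) = y by rewrite /f divff// scale1r addrC subrK.
rewrite -{1}f0 -{1}ft; apply: kob_chain_disc0; last by rewrite cmod_r2c gtr0_norm.
move=> z z1; split.
  apply: cdiffD; first exact: cdiff_cst.
  apply: cdiffZ; last exact: cdiff_cst.
  by apply: cdiffM; [exact: cdiff_id|exact: cdiff_cst].
apply: xO; rewrite /f addrAC subrr add0r rnormZ cmodM cmodV cmod_r2c gtr0_norm//.
apply: le_lt_trans (_ : cmod z / t * (r * t) < _).
  by rewrite ler_wpM2l// divr_ge0 ?cmod_ge0// ltW.
have -> : cmod z / t * (r * t) = cmod z * r by field; rewrite gt_eqF.
by rewrite gtr_pMl.
Qed.

Lemma poincare0_small (e : R) : 0 < e ->
  exists2 t : R, 0 < t < 1 & poincare0 (r2c t) <= e.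
Proof.
move=> e0; pose E := expR (2 * e).
have E1 : 1 < E by rewrite -expR0 ltr_expR mulr_gt0.
(* This is tanh e, at Poincare distance e from 0. *)
exists ((E - 1) / (E + 1)).
  by rewrite divr_gt0 ?ltr_pdivrMr//; lra.
set t := _ / _; have t0 : 0 < t by rewrite divr_gt0//; lra.
have t1 : t < 1 by rewrite ltr_pdivrMr; lra.
rewrite le_eqVlt; apply/orP; left; apply/eqP/poincare0_exp.
  by rewrite cmod_r2c gtr0_norm.
rewrite cmod_r2c gtr0_norm// -/E /t; field.
by rewrite !gt_eqF//; lra.
Qed.

Section Convex.
Variable O : set V.
Hypotheses (Oo : open O) (Oc : convex_set_Cd O).

Lemma open_ball x : O x -> exists2 r : R, 0 < r & forall z : V, rnorm (z - x) < r -> O z.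
Proof. by move=> Ox; apply/rnorm_nbhs; exact: open_nbhs_nbhs. Qed.

Lemma convO x y (t : R) : O x -> O y -> 0 <= t <= 1 ->
  O (r2c (1 - t) *: x + r2c t *: y).
Proof. by move=> Ox Oy t01; exact: Oc. Qed.

Lemma convE (s : R) (u v : V) :
  r2c (1 - s) *: u + r2c s *: v = u + r2c s *: (v - u).
Proof.
by rewrite r2cB r2c1 scalerBl scale1r scalerBr addrAC addrA.
Qed.

(** By convexity balls of one common radius fit along the whole segment, so finitely many equal
    steps suffice. The infimum defining the distance is then over a nonempty set, as every lower
    bound on it requires. *)
Lemma kob_chain_ex x y : O x -> O y -> exists s, kob_chain O x y s.
Proof.
move=> Ox Oy; have [r1 r10 xO] := open_ball Ox; have [r2 r20 yO] := open_ball Oy.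
pose r := Num.min r1 r2; have r0 : 0 < r by rewrite lt_min r10.
pose pt (s : R) : V := x + r2c s *: (y - x).
have ballO s : 0 <= s <= 1 -> forall z, rnorm (z - pt s) < r -> O z.
  move=> s01 z; rewrite lt_min => /andP[z1 z2]; set w := z - pt s in z1 z2.
  have -> : z = r2c (1 - s) *: (x + w) + r2c s *: (y + w).
    rewrite convE opprD addrACA subrr addr0 addrAC.
    by rewrite -/(pt s) /w addrC subrK.
  by apply: convO => //; [apply: xO|apply: yO]; rewrite addrAC subrr add0r.
have [N NP] : exists N : nat, rnorm (y - x) < r * 2^-1 * N.+1%:R.
  exists (Num.truncn (rnorm (y - x) / (r / 2))).
  by rewrite mulrC -ltr_pdivrMr ?divr_gt0// truncnS_gt.
have step k : (k <= N.+1)%N -> exists s, kob_chain O x (pt (k%:R / N.+1%:R)) s.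
  elim: k => [|k IH] kN.
    exists 0; rewrite mul0r /pt r2c0 scale0r addr0; exact: kob_chain0.
  have [s H] := IH (ltnW kN); exists (s + poincare0 (r2c 2^-1)).
  apply: kob_chain_cat H _; apply: (@kob_chain_ball _ _ _ r) => //.
  - apply: ballO; rewrite divr_ge0//= ler_pdivrMr ?ltr0n// mul1r ler_nat ltnW//.
  - by rewrite invr_gt0 ltr0n/= invf_lt1// ltr1n.
  - have -> : pt (k.+1%:R / N.+1%:R) - pt (k%:R / N.+1%:R) = r2c (N.+1%:R^-1) *: (y - x).
      rewrite /pt opprD addrACA subrr add0r -scalerBl; congr (_ *: _).
      by rewrite -r2cB -mulrBl -natrB// subSnn mul1r.
    rewrite rnormZ cmod_r2c gtr0_norm ?invr_gt0 ?ltr0n// mulrC ler_pdivrMr ?ltr0n//.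
    exact: ltW.
have [s] := step N.+1 (leqnn _).
rewrite divff ?pnatr_eq0// /pt r2c1 scale1r addrC subrK; by exists s.
Qed.

Lemma kob_lt x y (e : R) : O x -> O y -> kobayashi O x y < e ->
  exists2 s, kob_chain O x y s & s < e.
Proof. by move=> Ox Oy; apply: inf_lt; exact: kob_chain_ex. Qed.

Lemma kob_ge x y (e : R) : O x -> O y ->
  (forall s, kob_chain O x y s -> e <= s) -> e <= kobayashi O x y.
Proof. by move=> Ox Oy H; apply: lb_le_inf; [exact: kob_chain_ex|]. Qed.

Lemma kob_ge0 x y : O x -> O y -> 0 <= kobayashi O x y.
Proof. by move=> Ox Oy; apply: kob_ge => // s; exact: kob_chain_ge0. Qed.

Lemma kob_tri x y (z : V) : O x -> O y -> O z ->
  kobayashi O x z <= kobayashi O x y + kobayashi O y z.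
Proof.
move=> Ox Oy Oz; apply/ler_addgt0Pr => e e0.
have [|s Hs sl] := @kob_lt x y (kobayashi O x y + e / 2) Ox Oy.
  by rewrite ltrDl divr_gt0.
have [|s' Hs' sl'] := @kob_lt y z (kobayashi O y z + e / 2) Oy Oz.
  by rewrite ltrDl divr_gt0.
have := kob_le (kob_chain_cat Hs Hs'); lra.
Qed.

End Convex.

End Kobayashi.

(** * Half-plane bounds for the Kobayashi distance, and chains as curves *)

HB.lock Definition pairing (R : realType) (d : nat) (A : 'cV[Cplx R]_d) (z : Cd R d)
  : Cplx R := (z *m A) 0 0.

Section KobayashiConvex.
Variables (R : realType) (d : nat).
Local Notation C := (Cplx R).
Local Notation Re := (@complex.Re R).
Local Notation Im := (@complex.Im R).
Local Notation r2c := (@r2c R).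
Local Notation V := (Cd R d).
Variable O : set V.
Hypotheses (Oo : open O) (Oc : convex_set_Cd O).

Implicit Types A : 'cV[C]_d.

Lemma pairingD A z w : pairing A (z + w) = pairing A z + pairing A w.
Proof. by rewrite !pairing.unlock mulmxDl mxE. Qed.

Lemma pairingN A z : pairing A (- z) = - pairing A z.
Proof. by rewrite !pairing.unlock mulNmx mxE. Qed.

Lemma pairingB A z w : pairing A (z - w) = pairing A z - pairing A w.
Proof. by rewrite pairingD pairingN. Qed.

Lemma pairingZ A (a : C) z : pairing A (a *: z) = a * pairing A z.
Proof. by rewrite !pairing.unlock -scalemxAl mxE. Qed.

Lemma cdiff_pairing (f : C -> V) (z : C) A :
  cdiff f z -> cdiff (fun w => pairing A (f w)) z.
Proof. by rewrite pairing.unlock; exact: cdiff_coord. Qed.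

Lemma hol_into_pairing f A (c : C) : hol_into O f ->
  (forall z, O z -> Re (pairing A z - c) <= 0) -> forall t : C, cmod t < 1 ->
  cmod (pairing A (f t) - pairing A (f 0)) <=
    2 * cmod t / (1 - cmod t) * (- Re (pairing A (f 0) - c)).
Proof.
move=> fO A0 t t1.
have -> : pairing A (f t) - pairing A (f 0) =
  (pairing A (f t) - c) - (pairing A (f 0) - c) by ring.
apply: (@schwarz_halfplane R (fun z => pairing A (f z) - c)) => // z z1.
  have [fz _] := fO _ z1; apply: cdiffB; last exact: cdiff_cst.
  exact: cdiff_pairing.
by have [_ /A0] := fO _ z1.
Qed.

(** By Schwarz, one disk multiplies |pairing A - c| by at most (1 + |t|) / (1 - |t|), the
    exponential of twice its Poincare length; these factors multiply along a chain. *)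
Lemma kob_ge_halfplane A (c : C) x y : O x -> O y ->
  (forall z, O z -> Re (pairing A z - c) < 0) ->
  ln (cmod (pairing A y - c)) - ln (cmod (pairing A x - c)) <= 2 * kobayashi O x y.
Proof.
move=> Ox Oy A0.
have pos z : O z -> 0 < cmod (pairing A z - c).
  by move=> /A0 Az; rewrite cmod_gt0; apply/eqP => e; move: Az; rewrite e ltxx.
rewrite mulrC -ler_pdivrMr//; apply: kob_ge => // s xys.
rewrite ler_pdivrMr// mulrC lerBlDl.
suff : cmod (pairing A y - c) <= cmod (pairing A x - c) * expR (2 * s).
  move=> H; have -> : ln (cmod (pairing A x - c)) + 2 * s =
      ln (cmod (pairing A x - c) * expR (2 * s)).
    by rewrite lnM ?posrE ?expR_gt0 ?pos// expRK.
  rewrite ler_ln ?posrE ?pos//; apply: mulr_gt0; [exact: pos|exact: expR_gt0].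
move: x y s xys {Ox Oy}; apply: kob_chain_rec => [x|y s f t fO t1 H].
  by rewrite mulr0 expR0 mulr1.
apply: (le_trans H).
rewrite [2 * (_ + _)]mulrDr.
rewrite expRD [leRHS]mulrA.
apply: ler_wpM2r; first exact: expR_ge0.
have /(poincare0_exp _ t1) <- := erefl (poincare0 t).
have A0' z : O z -> Re (pairing A z - c) <= 0 by move=> /A0/ltW.
have := hol_into_pairing fO A0' t1; set u := pairing A (f 0) - c => Hu.
have -> : pairing A (f t) - c = u + (pairing A (f t) - pairing A (f 0)) by rewrite /u; ring.
apply: le_trans (cmodD _ _) _; apply: le_trans (lerD (lexx _) Hu) _.
have Ru : - Re u <= cmod u.
  by apply: le_trans (Re_le_cmod _); rewrite -normrN; exact: ler_norm.
have n1 : 1 - cmod t != 0 by rewrite subr_eq0 eq_sym lt_eqF.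
have -> : cmod u * ((1 + cmod t) / (1 - cmod t)) = cmod u + 2 * cmod t / (1 - cmod t) * cmod u.
  by field.
rewrite lerD2l ler_wpM2l// divr_ge0 ?mulr_ge0 ?cmod_ge0//.
by rewrite subr_ge0 ltW.
Qed.

Let tanhR (s : R) : R := (expR (2 * s) - 1) / (expR (2 * s) + 1).

Lemma tanhR_itv s : 0 <= s -> 0 <= tanhR s < 1.
Proof.
move=> s0; have e0 : 1 <= expR (2 * s) by rewrite -expR0 ler_expR mulr_ge0.
by rewrite /tanhR ltr_pdivrMr ?divr_ge0//=; lra.
Qed.

Lemma tanhRK s : expR (2 * s) = (1 + tanhR s) / (1 - tanhR s).
Proof.
have h : expR (2 * s) + 1 != 0 by rewrite gt_eqF// addr_gt0// expR_gt0.
rewrite /tanhR; field; rewrite h /=.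
have -> : expR (2 * s) + 1 - (expR (2 * s) - 1) = 2 by ring.
by rewrite pnatr_eq0.
Qed.

(* tanhR parametrizes a radius of the disk by Poincare length. *)
Lemma kob_radius f (u : C) (s s' : R) : hol_into O f -> cmod u = 1 -> 0 <= s <= s' ->
  kobayashi O (f (r2c (tanhR s) * u)) (f (r2c (tanhR s') * u)) <= s' - s.
Proof.
move=> fO u1 /andP[s0 ss'].
have s0' : 0 <= s' by apply: le_trans ss'.
have /andP[a0 a1] := tanhR_itv s0; have /andP[b0 b1] := tanhR_itv s0'.
have lt1 r : 0 <= tanhR r -> tanhR r < 1 -> cmod (r2c (tanhR r) * u) < 1.
  by move=> r0 r1; rewrite cmodM u1 mulr1 cmod_r2c ger0_norm.
apply: le_trans (kob_disc fO (lt1 s a0 a1) (lt1 s' b0 b1)) _.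
set t := mob _ _; have t1 : cmod t < 1 by apply: mob_lt1; rewrite ?cmodN; exact: lt1.
rewrite le_eqVlt; apply/orP; left; apply/eqP/(poincare0_exp _ t1).
set a := tanhR s in a0 a1 t t1 *; set b := tanhR s' in b0 b1 t t1 *.
have ab1 : 0 < 1 - a * b by rewrite subr_gt0 mulr_ilt1.
have ab : a <= b.
  have e0 := expR_gt0 (2 * s); have e0' := expR_gt0 (2 * s').
  rewrite /a /b /tanhR ler_pdivrMr ?addr_gt0// mulrAC ler_pdivlMr ?addr_gt0//.
  have : expR (2 * s) <= expR (2 * s') by rewrite ler_expR ler_pM2l.
  lra.
have ct : cmod t = (b - a) / (1 - a * b).
  have -> : t = r2c ((b - a) / (1 - a * b)) * u.
    rewrite /t /mob -mulNr -r2cN.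
    have -> : conjc (r2c (- a) * u) * (r2c b * u) = r2c (- (a * b)).
      have : cmod u ^+ 2 = 1 by rewrite u1 expr1n.
      rewrite cmod_sqr /r2c; case: (u) => p q /= pq; simpc.
      apply/eqP; rewrite eq_complex; apply/andP; split; apply/eqP => /=.
        by rewrite -[RHS]mulr1 -pq; ring.
      by ring.
    rewrite -mulrDl -r2cD -r2c1 -r2cD r2cM r2cV mulrAC; congr (_ / _ * u); congr r2c; ring.
  by rewrite cmodM u1 mulr1 cmod_r2c ger0_norm// divr_ge0 ?subr_ge0 ?(ltW ab1)// -subr_ge0 ltW.
rewrite ct.
have e0 := expR_gt0 (2 * s); have e0' := expR_gt0 (2 * s').
rewrite mulrBr expRD expRN.
have an : 1 - a != 0 by rewrite subr_eq0 eq_sym lt_eqF.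
have bn : 1 - b != 0 by rewrite subr_eq0 eq_sym lt_eqF.
have apn : 1 + a != 0 by rewrite gt_eqF//; lra.
rewrite (tanhRK s) (tanhRK s') -/a -/b.
field; rewrite an bn apn gt_eqF//=.
have -> : 1 - a * b - (b - a) = (1 + a) * (1 - b) by ring.
by rewrite mulf_neq0.
Qed.

(** The radii of the successive disks, each parametrized by Poincare length, are concatenated; the
    triangle inequality handles two times on different disks. *)
Lemma kob_curve x y S : O x -> kob_chain O x y S ->
  exists g : R -> V, [/\ 0 <= S, g 0 = x, g S = y & forall s s', 0 <= s -> s <= s' -> s' <= S ->
    [/\ O (g s), O (g s') & kobayashi O (g s) (g s') <= s' - s]].
Proof.
move=> Ox xyS; move: x y S xyS Ox; apply: kob_chain_rec.
  move=> x Ox; exists (fun=> x); split => // s s' s0 ss' s'0; split => //.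
  by rewrite kob_xx subr_ge0.
move=> y S f t fO t1 IH Of0; have [_ Oft] := fO _ t1.
have [g [S0 g0 gS gP]] := IH Oft.
pose L := poincare0 t; have L0 : 0 <= L by exact: poincare0_ge0.
(* A disk with t = 0 has length 0, so any direction will do. *)
pose u : C := if t == 0 then 1 else t / r2c (cmod t).
have u1 : cmod u = 1.
  rewrite /u; case: eqVneq => [_|tn0]; first exact: cmod1.
  by rewrite cmodM cmodV cmod_r2c ger0_norm ?cmod_ge0// divff// cmod_eq0.
have tu : t = r2c (cmod t) * u.
  rewrite /u; case: eqVneq => [->|tn0]; first by rewrite cmod0 r2c0 mul0r.
  by rewrite mulrCA divff ?mulr1// -cmod_eq0 cmod_r2c normr_eq0 cmod_eq0.
have tL : tanhR L = cmod t.
  have /(poincare0_exp _ t1) E := erefl (poincare0 t); rewrite /tanhR -E.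
  field; rewrite subr_eq0 eq_sym lt_eqF//=.
  have -> : 1 + cmod t + (1 - cmod t) = 2 by ring.
  by rewrite pnatr_eq0.
have t0 : tanhR 0 = 0 by rewrite /tanhR mulr0 expR0 subrr mul0r.
have Of r : 0 <= r -> O (f (r2c (tanhR r) * u)).
  move=> r0; have /andP[a0 a1] := tanhR_itv r0.
  by have [] := fO (r2c (tanhR r) * u); rewrite // cmodM u1 mulr1 cmod_r2c ger0_norm.
exists (fun r => if r <= L then f (r2c (tanhR r) * u) else g (r - L)); split.
- by rewrite addr_ge0.
- by rewrite L0 t0 r2c0 mul0r.
- case: ifPn => [SL|_]; last by rewrite addrC addKr.
  have S00 : S = 0 by apply/eqP; rewrite eq_le S0 andbT; move: SL; rewrite gerDl.
  by rewrite S00 addr0 tL -tu -gS S00 g0.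
move=> s s' s0 ss'; rewrite -/L => s'S; case: ifPn => sL; case: ifPn => s'L.
- by split; [exact: Of|apply: Of; lra|apply: kob_radius => //; rewrite s0].
- rewrite -ltNge in s'L.
  have [||| _ Og Hg] := gP 0 (s' - L); [by []|lra|lra|].
  split => //; first exact: Of.
  have sLs : 0 <= s <= L by rewrite s0.
  have := kob_radius fO u1 sLs; rewrite tL -tu => Hf.
  have := kob_tri Oo Oc (Of _ s0) Oft Og; move: Hg; rewrite g0; lra.
- by exfalso; move: sL; rewrite -ltNge; lra.
- rewrite -!ltNge in sL s'L.
  have [||| Og Og' Hg] := gP (s - L) (s' - L); [lra|lra|lra|].
  by split => //; lra.
Qed.

End KobayashiConvex.

(** * Hahn-Banach separation *)

Section Separation.
Variables (R : realType) (d : nat).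
Local Notation C := (Cplx R).
Local Notation Re := (@complex.Re R).
Local Notation Im := (@complex.Im R).
Local Notation r2c := (@r2c R).
Local Notation V := (Cd R d).

(* A maximal blunt cone M totally orders the space; for a point e of the open cone,
   v |-> sup {t | v - t e in M} is then a real linear functional. *)
Definition blunt_cone (K : set V) : Prop :=
  [/\ forall v w, K v -> K w -> K (v + w),
      forall (t : R) v, 0 < t -> K v -> K (r2c t *: v) & ~ K 0].

(** Zorn. If a maximal cone misses v, adjoining v must produce 0, and this puts - v in the cone. *)
Lemma blunt_cone_extend (K0 : set V) : blunt_cone K0 ->
  exists M, [/\ blunt_cone M, K0 `<=` M &
    forall v, v != 0 -> M v \/ M (- v)].
Proof.
move=> K0c.
(* Building [K0] into the property covers the empty chain. *)
pose P K := blunt_cone (K `|` K0).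
have [A [PA Amax]] : exists A, P A /\ forall B, A `<` B -> ~ P B.
  apply: Zorn_bigcup => F FP Ftot.
  have pick v w : (\bigcup_(X in F) X `|` K0) v -> (\bigcup_(X in F) X `|` K0) w ->
      (exists X, F X /\ (X `|` K0) v /\ (X `|` K0) w) \/ (K0 v /\ K0 w).
    case=> [[X FX Xv]|K0v]; case=> [[Y FY Yw]|K0w].
    - left; have [XY|YX] := Ftot _ _ FX FY.
        by exists Y; split => //; split; left => //; exact: XY.
      by exists X; split => //; split; left => //; exact: YX.
    - by left; exists X; split => //; split; [left|right].
    - by left; exists Y; split => //; split; [right|left].
    - by right.
  have up X v : F X -> (X `|` K0) v -> (\bigcup_(X in F) X `|` K0) v.
    by move=> FX [Xv|]; [left; exists X|right].
  split.
  - move=> v w Hv Hw; have [[X [FX [Xv Xw]]]|[K0v K0w]] := pick v w Hv Hw.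
      by apply: (up X) => //; have [XD _ _] := FP X FX; exact: XD.
    by right; have [K0D _ _] := K0c; exact: K0D.
  - move=> t v t0 Hv; have [[X [FX [Xv _]]]|[K0v _]] := pick v v Hv Hv.
      by apply: (up X) => //; have [_ XZ _] := FP X FX; exact: XZ.
    by right; have [_ K0Z _] := K0c; exact: K0Z.
  - move=> H0; have [[X [FX [X0 _]]]|[K00 _]] := pick 0 0 H0 H0.
      by have [_ _] := FP X FX.
    by have [_ _] := K0c.
exists (A `|` K0); split; [exact: PA|by move=> v; right|].
have [MD MZ M0] := PA.
have Mmax B : blunt_cone B -> A `|` K0 `<=` B -> B `<=` A `|` K0.
  move=> Bc MB; apply: contrapT => nBM; apply: (Amax B).
    split; last by move=> BA; apply: nBM => v /BA; left.
    by move=> v Av; apply: MB; left.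
  by rewrite /P; have -> : B `|` K0 = B by apply: setUidl => v K0v; apply: MB; right.
move=> v v0; have [Mv|nMv] := pselect ((A `|` K0) v); [by left|right].
set M := A `|` K0 in MD MZ M0 Mmax nMv *.
(* The cone generated by [M] and [v], with the trivial combination excluded. *)
pose B w := exists m (t : R), [/\ M m \/ m = 0, 0 <= t, M m \/ 0 < t & w = m + r2c t *: v].
have sumM m m' : M m \/ m = 0 -> M m' \/ m' = 0 -> M (m + m') \/ m + m' = 0.
  by move=> [Mm|->] [Mm'|->]; rewrite ?addr0 ?add0r; [left; exact: MD|left|left|right].
have [[m [t [Mm t0 Mt e]]]|nB0] := pselect (B 0).
  have [t00|tn0] := eqVneq t 0.
    have {}Mt : M m by case: Mt => //; rewrite t00 ltxx.
    by exfalso; apply: M0; move: e; rewrite t00 r2c0 scale0r addr0 => ->.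
  have tp : 0 < t by rewrite lt_def tn0.
  have tc : r2c t != 0 by rewrite -cmod_eq0 cmod_r2c normr_eq0.
  case: Mm => [Mm|m0]; last first.
    by move/eqP: e; rewrite m0 add0r eq_sym scaler_eq0 (negbTE tc) (negbTE v0).
  have -> : - v = r2c t^-1 *: m.
    have -> : m = - (r2c t *: v) by apply/eqP; rewrite -addr_eq0 -e.
    by rewrite scalerN scalerA r2cV mulVf// scale1r.
  by apply: MZ => //; rewrite invr_gt0.
exfalso; apply: nMv; apply: (Mmax B).
- split => //.
    move=> _ _ [m [t [Mm t0 Mt ->]]] [m' [t' [Mm' t0' Mt' ->]]].
    exists (m + m'), (t + t'); split; [exact: sumM|exact: addr_ge0| |].
      case: Mt => [Mm1|tp]; last by right; rewrite ltr_wpDr.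
      case: Mt' => [Mm1'|tp']; first by left; exact: MD.
      by right; rewrite ltr_wpDl.
    by rewrite r2cD scalerDl addrACA.
  move=> c _ c0 [m [t [Mm t0 Mt ->]]]; exists (r2c c *: m), (c * t); split.
  + by case: Mm => [Mm|->]; [left; exact: MZ|right; rewrite scaler0].
  + by rewrite mulr_ge0// ltW.
  + by case: Mt => [Mm'|tp]; [left; exact: MZ|right; rewrite mulr_gt0].
  + by rewrite scalerDr scalerA r2cM.
- move=> w Mw; exists w, 0; split => //; [by left|by left|].
  by rewrite r2c0 scale0r addr0.
- by exists 0, 1; split; [right|exact: ler01|right|rewrite r2c1 scale1r add0r].
Qed.

(** A real linear u is the real part of the complex linear functional u(v) - i u(i v), here read on
    the standard basis. *)
Lemma real_functional (u : V -> R) :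
  (forall v w, u (v + w) = u v + u w) ->
  (forall (t : R) v, u (r2c t *: v) = t * u v) ->
  exists A : 'cV[C]_d, forall v, Re (pairing A v) = u v.
Proof.
move=> uD uZ; have u0 : u 0 = 0.
  by have := uZ 0 0; rewrite scaler0 mul0r.
pose I : C := Complex 0 1.
exists (\col_i Complex (u (delta_mx 0 i)) (- u (I *: delta_mx 0 i))) => v.
rewrite [in RHS](row_sum_delta v) (big_morph u uD u0) pairing.unlock mxE.
rewrite (big_morph (@complex.Re R) (@cReD R) (erefl : Re 0 = 0)).
apply: eq_bigr => i _; rewrite mxE cReM /=.
have -> : v 0 i *: delta_mx 0 i = r2c (Re (v 0 i)) *: delta_mx 0 i +
    r2c (Im (v 0 i)) *: (I *: delta_mx 0 i) :> V.
  rewrite scalerA -scalerDl; congr (_ *: _).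
  by case: (v 0 i) => a b; rewrite /r2c /I; simpc.
by rewrite uD !uZ mulrN opprK.
Qed.

Variable O : set V.
Hypotheses (Oo : open O) (Oc : convex_set_Cd O).

(** The functional is sought positive on the cone spanned by the q - z with z in [O], which is blunt
    because q is outside [O]. *)
Lemma separation q : O !=set0 -> ~ O q ->
  exists A : 'cV[C]_d, forall z, O z -> Re (pairing A (z - q)) < 0.
Proof.
move=> [x0 Ox0] nOq.
pose K0 w := exists (t : R) z, [/\ 0 < t, O z & w = r2c t *: (q - z)].
have tc (t : R) : 0 < t -> r2c t != 0.
  by move=> t0; rewrite -cmod_eq0 cmod_r2c normr_eq0 gt_eqF.
have K0c : blunt_cone K0.
  split.
  - move=> _ _ [t [z [t0 Oz ->]]] [s [w [s0 Ow ->]]].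
    have ts0 : 0 < t + s by rewrite addr_gt0.
    exists (t + s), (r2c (1 - s / (t + s)) *: z + r2c (s / (t + s)) *: w); split => //.
      apply: convO => //.
      by rewrite divr_ge0 ?(ltW s0) ?(ltW ts0)//= ler_pdivrMr// mul1r lerDr ltW.
    have E1 : r2c (t + s) * r2c (1 - s / (t + s)) = r2c t.
      by rewrite -r2cM; congr r2c; field; rewrite gt_eqF.
    have E2 : r2c (t + s) * r2c (s / (t + s)) = r2c s.
      by rewrite -r2cM; congr r2c; field; rewrite gt_eqF.
    have E : r2c (t + s) *: (r2c (1 - s / (t + s)) *: z + r2c (s / (t + s)) *: w) =
        r2c t *: z + r2c s *: w by rewrite scalerDr !scalerA E1 E2.
    by rewrite [RHS]scalerBr E r2cD scalerDl opprD addrACA -!scalerBr.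
  - move=> t _ t0 [s [z [s0 Oz ->]]]; exists (t * s), z; split => //.
      exact: mulr_gt0.
    by rewrite scalerA r2cM.
  - move=> [t [z [t0 Oz /eqP]]]; rewrite eq_sym scaler_eq0 (negbTE (tc t t0)) /=.
    by rewrite subr_eq0 => /eqP qz; apply: nOq; rewrite qz.
have [M [[MD MZ M0] K0M Mtot]] := blunt_cone_extend K0c.
pose e := q - x0.
have K0q z : O z -> M (q - z).
  by move=> Oz; apply: K0M; exists 1, z; rewrite r2c1 scale1r.
have Me : M e by exact: K0q.
have M2 v : M v -> M (- v) -> False.
  by move=> Mv Mv'; apply: M0; rewrite -(subrr v); exact: MD.
have [r r0 x0O] := open_ball Oo Ox0.
(* [e] is an order unit since [x0] is interior; this makes the suprema below finite. *)
have big w : exists T : R, M (w + r2c T *: e).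
  pose T := (rnorm w + 1) / r.
  have T0 : 0 < T by rewrite divr_gt0// ltr_wpDl ?rnorm_ge0.
  exists T; have -> : w + r2c T *: e = r2c T *: (e + r2c T^-1 *: w).
    by rewrite [RHS]scalerDr scalerA r2cV divff ?tc// scale1r addrC.
  apply: MZ => //; have -> : e + r2c T^-1 *: w = q - (x0 - r2c T^-1 *: w).
    by rewrite opprB /e addrAC addrA.
  apply/K0q/x0O; rewrite addrAC subrr add0r rnormN rnormZ cmod_r2c.
  rewrite gtr0_norm ?invr_gt0// mulrC ltr_pdivrMr// /T mulrCA divff ?gt_eqF// mulr1.
  by rewrite ltrDl.
have Mge w (s t : R) : s < t -> M (w - r2c t *: e) -> M (w - r2c s *: e).
  move=> st Mt; have -> : w - r2c s *: e = (w - r2c t *: e) + r2c (t - s) *: e.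
    by rewrite r2cB scalerBl addrA subrK.
  by apply: MD => //; apply: MZ => //; rewrite subr_gt0.
pose S w := [set t : R | M (w - r2c t *: e)].
have SP w : has_sup (S w).
  split.
    by have [T MT] := big w; exists (- T); rewrite /S/= r2cN scaleNr opprK.
  have [T MT] := big (- w); exists T => t /= Mt.
  rewrite leNgt; apply/negP => Tt; apply: (M2 (w - r2c T *: e)).
    exact: Mge Tt Mt.
  by rewrite opprB addrC.
pose u w := sup (S w).
have uL w t : t < u w -> M (w - r2c t *: e).
  move=> tu; have [s Ss ts] := sup_gt (SP w).1 tu; exact: Mge ts Ss.
have uU w t : u w < t -> M (r2c t *: e - w).
  move=> ut; pose s := (u w + t) / 2.
  have [us st] : u w < s /\ s < t by rewrite /s; split; lra.
  have nS : ~ M (w - r2c s *: e).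
    move=> Ms; move: us; rewrite ltNge => /negP; apply.
    by apply: ub_le_sup => //; exact: (SP w).2.
  have -> : r2c t *: e - w = r2c (t - s) *: e + (r2c s *: e - w).
    by rewrite r2cB scalerBl addrA subrK.
  have Mts : M (r2c (t - s) *: e) by apply: MZ => //; rewrite subr_gt0.
  have [se|se] := eqVneq (w - r2c s *: e) 0.
    by rewrite -[X in _ + X]opprB se oppr0 addr0.
  by have [//|H] := Mtot _ se; apply: MD => //; rewrite -opprB.
have uE w t : (forall s, s < t -> M (w - r2c s *: e)) ->
    (forall s, t < s -> M (r2c s *: e - w)) -> u w = t.
  move=> H1 H2; apply/eqP; rewrite eq_le !leNgt; apply/andP; split; apply/negP => tu.
    pose s := (t + u w) / 2; have [a b] : t < s /\ s < u w by rewrite /s; split; lra.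
    by apply: (M2 (w - r2c s *: e)); [exact: uL|rewrite opprB; exact: H2].
  pose s := (t + u w) / 2; have [a b] : u w < s /\ s < t by rewrite /s; split; lra.
  by apply: (M2 (w - r2c s *: e)); [exact: H1|rewrite opprB; exact: uU].
have uD v w : u (v + w) = u v + u w.
  apply: uE => s su; pose k := (s - (u v + u w)) / 2;
    have kE : u v + k + (u w + k) = s by rewrite /k; field.
    have -> : v + w - r2c s *: e = (v - r2c (u v + k) *: e) + (w - r2c (u w + k) *: e).
      by rewrite addrACA -opprD -scalerDl -r2cD kE.
    by apply: MD; apply: uL; rewrite /k; lra.
  have -> : r2c s *: e - (v + w) = (r2c (u v + k) *: e - v) + (r2c (u w + k) *: e - w).
    by rewrite addrACA -opprD -scalerDl -r2cD kE.
  by apply: MD; apply: uU; rewrite /k; lra.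
have uN v : u (- v) = - u v.
  apply: uE => s su.
    by rewrite addrC -scaleNr -r2cN; apply: uU; lra.
  by rewrite opprK addrC -[r2c s *: e]opprK -scaleNr -r2cN; apply: uL; lra.
have uZp t v : 0 < t -> u (r2c t *: v) = t * u v.
  move=> t0; have sE s : r2c s *: e = r2c t *: (r2c (s / t) *: e).
    by rewrite scalerA -r2cM; congr (r2c _ *: _); field; rewrite gt_eqF.
  apply: uE => s su; rewrite (sE s) -scalerBr; apply: MZ => //; [apply: uL|apply: uU].
    by rewrite ltr_pdivrMr// mulrC.
  by rewrite ltr_pdivlMr// mulrC.
have u0 : u 0 = 0 by have := uD 0 0; rewrite addr0; lra.
have uZ t v : u (r2c t *: v) = t * u v.
  have [t0|t0|->] := ltgtP t 0; last by rewrite r2c0 scale0r mul0r.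
    have := uZp (- t) v; rewrite oppr_gt0 => /(_ t0).
    by rewrite r2cN scaleNr uN mulNr => /oppr_inj.
  exact: uZp.
have [A AP] := real_functional uD uZ.
exists A => z Oz; rewrite AP -opprB uN oppr_lt0.
(* Strictness comes from openness: z + t e is still in [O], so u (q - z) is at least t. *)
have [s s0 zO] := open_ball Oo Oz.
pose t := s / (rnorm e + 1).
have e10 : 0 < rnorm e + 1 by rewrite ltr_wpDl ?rnorm_ge0.
have t0 : 0 < t by rewrite divr_gt0.
apply: (lt_le_trans t0); apply: ub_le_sup; first exact: (SP _).2.
rewrite /S/= -addrA -opprD; apply/K0q/zO; rewrite addrAC subrr add0r rnormZ cmod_r2c (gtr0_norm t0).
by rewrite /t mulrAC ltr_pdivrMr// ltr_pM2l// ltrDl.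
Qed.

End Separation.

(** * Geometry of C-proper convex sets *)

(** The kernel shrinks: [v] is killed by [D] but not by the larger matrix. *)
Lemma rank_row_mx_ltn (F : fieldType) m n p (D : 'M[F]_(m, n)) (A : 'M[F]_(m, p))
  (v : 'rV[F]_m) : v *m D = 0 -> v *m A != 0 -> (\rank D < \rank (row_mx D A))%N.
Proof.
move=> vD vA; have lt : (kermx (row_mx D A) < kermx D)%MS.
  rewrite ltmxE; apply/andP; split.
    apply/sub_kermxP; have := mulmx_ker (row_mx D A).
    by rewrite mul_mx_row => /eqP; rewrite row_mx_eq0 => /andP[/eqP].
  have /submx_trans vker : (v <= kermx D)%MS by exact/sub_kermxP.
  apply/negP => /vker /sub_kermxP/eqP.
  by rewrite mul_mx_row row_mx_eq0 (negbTE vA) andbF.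
have := rank_ltmx lt; rewrite !mxrank_ker.
by have := rank_leq_row D; have := rank_leq_row (row_mx D A); lia.
Qed.

Section ConvexSets.
Variables (R : realType) (d : nat).
Local Notation C := (Cplx R).
Local Notation Re := (@complex.Re R).
Local Notation Im := (@complex.Im R).
Local Notation r2c := (@r2c R).
Local Notation V := (Cd R d).
Variable O : set V.
Hypotheses (Oo : open O) (Oc : convex_set_Cd O).

Lemma closure_rnorm (S : set V) y :
  closure S y <-> forall e : R, 0 < e -> exists2 z, S z & rnorm (z - y) < e.
Proof.
split => [cSy e e0|H B /rnorm_nbhs[e e0 eB]].
  have [|z [Sz /= zB]] := cSy [set z | rnorm (z - y) < e].
    by apply/rnorm_nbhs; exists e.
  by exists z.
by have [z Sz zy] := H e e0; exists z; split => //; exact: eB.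
Qed.

(** Replace y by a nearby point of [O] and compensate by moving x inside its ball; the ratio (1 - s)
    / s dictates how near. *)
Lemma conv_interior_closure x y (s : R) : O x -> closure O y -> 0 < s <= 1 ->
  O (r2c (1 - s) *: y + r2c s *: x).
Proof.
move=> Ox /closure_rnorm cy /andP[s0 s1]; have [r r0 xO] := open_ball Oo Ox.
have [|y' Oy' yy'] := cy (r * s); first exact: mulr_gt0.
have sn : r2c s != 0 by rewrite -cmod_eq0 cmod_r2c normr_eq0 gt_eqF.
have -> : r2c (1 - s) *: y + r2c s *: x =
    r2c (1 - s) *: y' + r2c s *: (x + r2c ((1 - s) / s) *: (y - y')).
  have E : r2c s *: (x + r2c ((1 - s) / s) *: (y - y')) =
      r2c s *: x + r2c (1 - s) *: (y - y').
    by rewrite scalerDr scalerA -r2cM mulrC divfK ?gt_eqF.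
  by rewrite E addrCA -scalerDr [y' + _]addrC subrK addrC.
apply: convO => //; last by rewrite ltW.
apply: xO; rewrite addrAC subrr add0r rnormZ cmod_r2c rnormBC ger0_norm; last first.
  by rewrite divr_ge0 ?subr_ge0 ?(ltW s0).
have [->|s1'] := eqVneq s 1; first by rewrite subrr !mul0r.
have sp : 0 < 1 - s by rewrite subr_gt0 lt_def eq_sym s1'.
apply: lt_le_trans (_ : (1 - s) / s * (r * s) <= _).
  by rewrite ltr_pM2l// divr_gt0.
have -> : (1 - s) / s * (r * s) = (1 - s) * r by field; rewrite gt_eqF.
by rewrite ler_piMl ?(ltW r0)//; lra.
Qed.

Lemma halfplane_closure A q y : O !=set0 ->
  (forall z, O z -> Re (pairing A (z - q)) < 0) -> closure O y ->
  Re (pairing A (y - q)) <= 0.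
Proof.
move=> [x Ox] A0 cy; rewrite leNgt; apply/negP => p0.
have n0 := A0 x Ox.
set p := Re (pairing A (y - q)) in p0; set n := Re (pairing A (x - q)) in n0.
(* At this parameter the functional would vanish, yet the point lies in [O]. *)
pose s := p / (p - n); have pn : 0 < p - n by lra.
have s0 : 0 < s by rewrite divr_gt0.
have s1 : s <= 1 by rewrite ler_pdivrMr//; lra.
have s01 : 0 < s <= 1 by rewrite s0.
have := A0 _ (conv_interior_closure Ox cy s01).
have -> : r2c (1 - s) *: y + r2c s *: x - q = r2c (1 - s) *: (y - q) + r2c s *: (x - q).
  rewrite !scalerBr addrACA -opprD -scalerDl -r2cD subrK r2c1 scale1r//.
rewrite pairingD 2!pairingZ cReD 2!cReM 2!Re_r2c 2!Im_r2c 2!mul0r 2!subr0 -/p -/n.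
have -> : (1 - s) * p + s * n = p - s * (p - n) by ring.
by rewrite /s divfK ?gt_eqF// subrr ltxx.
Qed.

Lemma rotate_to_norm (p : C) : exists2 u : C, cmod u = 1 & u * p = r2c (cmod p).
Proof.
have [->|p0] := eqVneq p 0; first by exists 1; rewrite ?cmod1// cmod0 mulr0.
exists (r2c (cmod p) / p); last by rewrite divfK.
by rewrite cmodM cmodV cmod_r2c ger0_norm ?cmod_ge0// divff// cmod_eq0.
Qed.

(** Rotating h makes its pairing real and nonnegative without leaving the ball, so the half-plane
    bounds it. *)
Lemma pairing_ball A x w (r : R) : (forall z, rnorm (z - x) < r -> O z) ->
  (forall z, O z -> Re (pairing A (z - w)) < 0) ->
  forall h, rnorm h < r -> cmod (pairing A h) <= cmod (pairing A (x - w)).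
Proof.
move=> xO A0 h hr; have [u u1 up] := rotate_to_norm (pairing A h).
have := A0 (x + u *: h); rewrite addrAC pairingD pairingZ up !ReImE => H.
have {}H : Re (pairing A (x - w)) + cmod (pairing A h) < 0.
  by apply: H; apply: xO; rewrite addrAC subrr add0r rnormZ u1 mul1r.
apply: le_trans (Re_le_cmod _); rewrite ler_normr; apply/orP; right; lra.
Qed.

Lemma halfplane_ball_ratio A c x z (M : R) : O x -> O z -> kobayashi O x z <= M ->
  (forall z, O z -> Re (pairing A z - c) < 0) ->
  cmod (pairing A z - c) <= expR (2 * M) * cmod (pairing A x - c).
Proof.
move=> Ox Oz xzM A0.
have pos v : O v -> 0 < cmod (pairing A v - c).
  by move=> /A0 Av; rewrite cmod_gt0; apply/eqP => e; move: Av; rewrite e ltxx.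
have := kob_ge_halfplane Oo Oc Ox Oz A0 => H.
rewrite -ler_ln ?posrE ?pos//; last by rewrite mulr_gt0 ?expR_gt0 ?pos.
by rewrite lnM ?posrE ?expR_gt0 ?pos// expRK; lra.
Qed.

(** If w is outside [O] and close to z, a functional separating w is much smaller on z - w than on x
    - w, because [O] contains a ball about x. [halfplane_ball_ratio] forbids this; the factor 2 in
    the radius makes the contradiction strict. *)
Lemma kob_ball_dist_boundary x (M : R) : O x -> exists2 r : R, 0 < r &
  forall z, O z -> kobayashi O x z <= M -> forall w, rnorm (w - z) < r -> O w.
Proof.
move=> Ox; have [r0 r00 xO] := open_ball Oo Ox.
pose E := expR (2 * M); have E0 : 0 < E by exact: expR_gt0.
exists (r0 / (2 * E)); first by rewrite divr_gt0 ?mulr_gt0.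
move=> z Oz xzM w wz; apply: contrapT => nOw.
have [A A0] := separation Oo Oc (ex_intro _ x Ox) nOw.
have A0' v : O v -> Re (pairing A v - pairing A w) < 0.
  by move=> /A0; rewrite pairingB.
have L0 : 0 < cmod (pairing A (x - w)).
  by rewrite cmod_gt0; apply/eqP => e; have := A0 _ Ox; rewrite e ltxx.
have xzM' : kobayashi O z x <= M by rewrite kob_sym.
have := halfplane_ball_ratio Oz Ox xzM' A0'; rewrite -!pairingB -/E => H.
have : cmod (pairing A (r2c (2 * E) *: (z - w))) <= cmod (pairing A (x - w)).
  apply: pairing_ball xO A0 _ _.
  rewrite rnormZ cmod_r2c gtr0_norm ?mulr_gt0// rnormBC mulrC -ltr_pdivlMr//.
  by rewrite mulr_gt0.
rewrite pairingZ cmodM cmod_r2c gtr0_norm ?mulr_gt0//; lra.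
Qed.

(** Take v killed by all columns of [D]. The complex line through a point of [O] in direction v
    leaves [O] by C-properness, and a functional separating an exit point is nonzero on v. *)
Lemma halfplane_independent n (D : 'M[C]_(d, n)) : C_proper O -> O !=set0 ->
  (forall j, exists c, forall z, O z -> Re (pairing (col j D) z - c) < 0) ->
  (\rank D < d)%N ->
  exists A : 'cV[C]_d, (exists c, forall z, O z -> Re (pairing A z - c) < 0) /\
    (\rank D < \rank (row_mx D A))%N.
Proof.
move=> Opr [a Oa] DF rD.
have /rowV0Pn[v vker v0] : kermx D != 0.
  by rewrite -mxrank_eq0 mxrank_ker subn_eq0 -ltnNge.
have vD : v *m D = 0 by exact/sub_kermxP.
have [A [AF Av]] : exists A, (exists c, forall z, O z -> Re (pairing A z - c) < 0) /\
    pairing A v != 0.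
  apply: contrapT => H; apply: Opr; exists a, v; split => // t.
  apply: contrapT => nO.
  have [A A0] := separation Oo Oc (ex_intro _ a Oa) nO; apply: H; exists A; split.
    by exists (pairing A (a + t *: v)) => z Oz; rewrite -pairingB; exact: A0.
  apply: contraPneq (A0 a Oa) => Av0.
  by rewrite opprD addrA subrr sub0r pairingN pairingZ Av0 mulr0 oppr0 ltxx.
exists A; split => //.
apply: (rank_row_mx_ltn vD); apply: contra_neq Av => vA.
by rewrite pairing.unlock vA mxE.
Qed.

Lemma halfplane_basis : C_proper O -> O !=set0 ->
  exists n (D : 'M[C]_(d, n)), row_free D /\
   (forall j, exists c, forall z, O z -> Re (pairing (col j D) z - c) < 0).
Proof.
move=> Opr On.
have H k : (k <= d)%N -> exists n (D : 'M[C]_(d, n)), (k <= \rank D)%N /\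
   (forall j, exists c, forall z, O z -> Re (pairing (col j D) z - c) < 0).
  elim: k => [|k IH] kd; first by exists 0%N, 0; split => // -[].
  have [n [D [kD DF]]] := IH (ltnW kd).
  have [rD|rD] := ltnP (\rank D) d; last first.
    by exists n, D; split => //; exact: leq_trans rD.
  have [A [AF rA]] := halfplane_independent Opr On DF rD.
  exists (n + 1)%N, (row_mx D A); split; first exact: leq_ltn_trans rA.
  move=> j; case: (split_ordP j) => i ->.
    by have [c cP] := DF i; exists c => z; rewrite colKl; exact: cP.
  by have [c cP] := AF; exists c => z; rewrite colKr col_id; exact: cP.
have [n [D [dD DF]]] := H d (leqnn d); exists n, D; split => //.
by rewrite /row_free eqn_leq rank_leq_row.
Qed.

(** Each functional of [halfplane_basis] is bounded on the ball, and a right inverse of [D] recovers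
    the coordinates. *)
Lemma kob_ball_bounded x (M : R) : C_proper O -> O x -> exists B : R,
  forall z, O z -> kobayashi O x z <= M -> forall i, cmod (z 0 i) <= B.
Proof.
move=> Opr Ox.
have [n [D [/row_freeP[D' DD'] DF]]] := halfplane_basis Opr (ex_intro _ x Ox).
have [c cP] := choice DF.
pose b j := cmod (c j) + expR (2 * M) * cmod (pairing (col j D) x - c j).
exists (\sum_j b j * \sum_i cmod (D' j i)) => z Oz xzM i.
have -> : z = (z *m D) *m D' by rewrite -mulmxA DD' mulmx1.
rewrite mxE; apply: le_trans (cmod_sum _) _; apply: ler_sum => j _.
rewrite cmodM; apply: ler_pM; rewrite ?cmod_ge0//.
  have -> : (z *m D) 0 j = c j + (pairing (col j D) z - c j).
    by rewrite addrC subrK pairing.unlock !mxE; apply: eq_bigr => k _; rewrite [in RHS]mxE.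
  apply: le_trans (cmodD _ _) _; rewrite lerD2l.
  exact: (halfplane_ball_ratio Ox Oz xzM (cP j)).
by rewrite (bigD1 i)//= lerDl sumr_ge0// => k _; exact: cmod_ge0.
Qed.

End ConvexSets.

(** * Geodesics *)

(** The limit is the supremum of the numbers lying below [u] along [U]. *)
Lemma ultra_bounded_lim (R : realType) (U : set_system nat) (u : nat -> R) (B : R) :
  UltraFilter U -> (forall n, `|u n| <= B) ->
  exists l, forall e, 0 < e -> U [set n | `|u n - l| < e].
Proof.
move=> FU uB; pose S := [set a : R | U [set n | a <= u n]].
have Sub : has_sup S.
  split.
    exists (- B); rewrite /S/=; apply: filterS filterT => n _ /=.
    by have := uB n; rewrite ler_norml => /andP[].
  exists B => a /filter_ex[n /= an]; apply: le_trans an _.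
  by have := uB n; rewrite ler_norml => /andP[].
exists (sup S) => e e0.
have [a Sa ae] : exists2 a, S a & sup S - e < a.
  by apply: sup_gt; [exact: Sub.1|rewrite ltrBlDr ltrDl].
have ub : U [set n | u n < sup S + e].
  have [H|H] := in_ultra_setVsetC [set n | sup S + e <= u n] FU.
    have : sup S + e <= sup S by apply: ub_le_sup => //; exact: Sub.2.
    by rewrite gerDl leNgt e0.
  by apply: filterS H => n /= /negP; rewrite -ltNge.
apply: filterS2 Sa ub => n /= an nu; rewrite ltr_norml; apply/andP; split; lra.
Qed.

Section Geodesics.
Variables (R : realType) (d : nat).
Local Notation C := (Cplx R).
Local Notation Re := (@complex.Re R).
Local Notation Im := (@complex.Im R).
Local Notation r2c := (@r2c R).
Local Notation V := (Cd R d).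
Variable O : set V.
Hypotheses (Oo : open O) (Oc : convex_set_Cd O) (Opr : C_proper O).
Local Notation kob := (kobayashi O).

Lemma ultra_row_lim (U : set_system nat) (u : nat -> V) (B : R) :
  UltraFilter U -> (forall n i, cmod (u n 0 i) <= B) ->
  exists l, forall e : R, 0 < e -> U [set n | rnorm (u n - l) < e].
Proof.
move=> FU uB.
have /choice[l lP] : forall i, exists c : C, forall e : R, 0 < e ->
    U [set n | cmod (u n 0 i - c) < e].
  move=> i.
  have [|a aP] := @ultra_bounded_lim _ U (fun n => Re (u n 0 i)) B FU.
    by move=> n; apply: le_trans (Re_le_cmod _) (uB n i).
  have [|b bP] := @ultra_bounded_lim _ U (fun n => Im (u n 0 i)) B FU.
    by move=> n; apply: le_trans (Im_le_cmod _) (uB n i).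
  exists (Complex a b) => e e0; have e20 : 0 < e / 2 by rewrite divr_gt0.
  apply: filterS2 (aP _ e20) (bP _ e20) => n /= an bn.
  apply: le_lt_trans (cmod_le_ReIm _) _; rewrite cReD cReN cImD cImN Re_C Im_C.
  by move: an bn; set p := `|_|; set q := `|_|; lra.
exists (\row_i l i) => e e0.
have : U [set n | forall i, cmod (u n 0 i - l i) < e].
  by apply: filter_forall => i; exact: lP.
apply: filterS => n nP /=; apply: rnorm_row_lt => // i.
by rewrite !mxE; exact: nP.
Qed.

(** Rescale the curve of a chain whose length S exceeds the distance D by less than e. No portion
    can lose more than the total excess S - D, since its complement would otherwise make up a
    shortcut. *)
Lemma almost_geodesic x y (e : R) : O x -> O y -> 0 < kob x y -> 0 < e ->
  exists f : R -> V, [/\ f 0 = x, f (kob x y) = y &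
    forall s t : R, 0 <= s -> s <= t -> t <= kob x y ->
      [/\ O (f s), O (f t) & `|kob (f s) (f t) - (t - s)| <= e]].
Proof.
move=> Ox Oy; set D := kob x y => D0 e0.
have [|S xyS SD] := @kob_lt _ _ O Oo Oc x y (D + e) Ox Oy; first by rewrite ltrDl.
have DS : D <= S by exact: kob_le.
have [g [S0 g0 gS gP]] := kob_curve Oo Oc Ox xyS.
exists (fun s => g (s * (S / D))); split; first by rewrite mul0r.
  by rewrite mulrC divfK ?gt_eqF.
move=> s t s0 st tD; pose k := S / D.
have k1 : 1 <= k by rewrite ler_pdivlMr// mul1r.
have Dk : D * k = S by rewrite /k mulrC divfK ?gt_eqF.
have a0 : 0 <= s * k by rewrite mulr_ge0//; lra.
have a1 : s * k <= t * k by rewrite ler_wpM2r//; lra.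
have a2 : t * k <= S by rewrite -Dk ler_wpM2r//; lra.
have [Os Ot H] := gP _ _ a0 a1 a2; split => //.
have [//|//||_ _ H1] := gP 0 (s * k); first by apply: le_trans a1 a2.
have [||//|_ _ H2] := gP (t * k) S; first by apply: le_trans a1.
  by [].
rewrite g0 subr0 in H1; rewrite gS in H2.
have T1 := kob_tri Oo Oc Ox Os Oy; have T2 := kob_tri Oo Oc Os Ot Oy.
rewrite -/D in T1.
have b1 : (t - s) * (k - 1) <= D * (k - 1) by rewrite ler_wpM2r//; lra.
have b2 : 0 <= (t - s) * (k - 1) by rewrite mulr_ge0//; lra.
rewrite -/k ler_norml; apply/andP; split; lra.
Qed.

(* The pointwise limit, along an ultrafilter, of almost geodesics; no equicontinuity
   is needed. *)
Lemma geodesic_exists x y : O x -> O y -> 0 < kob x y ->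
  exists sigma, geodesic O kob sigma 0 (kob x y) x y.
Proof.
move=> Ox Oy D0; set D := kob x y in D0 *.
have en n : 0 < n.+1%:R^-1 :> R by rewrite invr_gt0 ltr0n.
have [f fP] := choice (fun n => almost_geodesic Ox Oy D0 (en n)).
have fO n (s : R) : 0 <= s <= D -> O (f n s) /\ kob x (f n s) <= D + 1.
  move=> /andP[s0 sD]; have [f0 fD fn] := fP n.
  have [//|//|//|_ Of] := fn 0 s; rewrite f0 subr0 ler_norml => /andP[_ h]; split => //.
  have : n.+1%:R^-1 <= 1 :> R by rewrite invf_le1 ?ltr0n// ler1n.
  move: h; set v := _^-1; set k := kob _ _ => h v1; lra.
have [B BP] := kob_ball_bounded Oo Oc (D + 1) Opr Ox.
have [r r0 rP] := kob_ball_dist_boundary Oo Oc (D + 1) Ox.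
have [U [FU sU]] := ultraFilterLemma eventually_filter.
have Un (e : R) : 0 < e -> U [set n | n.+1%:R^-1 < e].
  move=> e0; apply: sU; exists (Num.truncn e^-1) => // n /= Nn.
  rewrite -[e]invrK ltf_pV2 ?posrE ?ltr0n ?invr_gt0//.
  by apply: lt_le_trans (truncnS_gt _) _; rewrite ler_nat.
have /choice[sigma sP] : forall s : R, exists l : V, 0 <= s <= D ->
    forall e : R, 0 < e -> U [set n | rnorm (f n s - l) < e].
  move=> s; have [sD|sD] := boolP (0 <= s <= D); last by exists 0.
  have [|l lP] := @ultra_row_lim U (fun n => f n s) B FU; last by exists l.
  by move=> n i; have [Of kf] := fO n s sD; exact: BP.
have limE (s : R) v : 0 <= s <= D -> (forall n, f n s = v) -> sigma s = v.
  move=> sD fv; apply/eqP; rewrite eq_sym -subr_eq0 -rnorm_eq0 eq_le rnorm_ge0 andbT.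
  rewrite leNgt; apply/negP => h.
  by have /filter_ex[n /=] := sP s sD _ h; rewrite fv ltxx.
(* Balls of the fixed radius [r] about the [f n s] lie in [O], so the limit does not reach the
   boundary. *)
have sO (s : R) : 0 <= s <= D -> O (sigma s).
  move=> sD; have /filter_ex[n /= nr] := sP s sD r r0; have [Of kf] := fO n s sD.
  by apply: (rP (f n s)) => //; rewrite rnormBC.
(* The same radius for all n turns convergence in norm into convergence for the Kobayashi
   distance. *)
have near (s e : R) : 0 <= s <= D -> 0 < e -> U [set n | kob (f n s) (sigma s) <= e].
  move=> sD e0; have [t /andP[t0 t1] te] := poincare0_small e0.
  have rt : 0 < r * t by rewrite mulr_gt0.
  apply: filterS (sP s sD _ rt) => n /= nr; have [Of kf] := fO n s sD.
  apply: le_trans te; apply: kob_le; apply: (@kob_chain_ball _ _ _ _ _ r) => //.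
  - by move=> z; exact: rP.
  - by rewrite t0.
  - by rewrite rnormBC ltW.
have main (s t : R) : 0 <= s -> s <= t -> t <= D -> kob (sigma s) (sigma t) = t - s.
  move=> s0 st tD; have sD : 0 <= s <= D by rewrite s0/=; lra.
  have tD' : 0 <= t <= D by rewrite tD andbT; lra.
  apply/eqP; rewrite -subr_eq0 -normr_eq0 eq_le normr_ge0 andbT.
  apply/ler_addgt0Pr => e e0; rewrite add0r.
  have e30 : 0 < e / 3 by rewrite divr_gt0.
  have [n [[/= n1 n2] n3]] := filter_ex (filterI (filterI (near s _ sD e30) (near t _ tD' e30)) (Un _ e30)).
  have [f0 fD fn] := fP n; have [Of Og H] := fn s t s0 st tD.
  have Os := sO s sD; have Ot := sO t tD'.
  have T1 := kob_tri Oo Oc Os Of Ot; have T2 := kob_tri Oo Oc Of Og Ot.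
  have T3 := kob_tri Oo Oc Of Os Og; have T4 := kob_tri Oo Oc Os Ot Og.
  rewrite (kob_sym _ (sigma s) (f n s)) in T1; rewrite (kob_sym _ (sigma t) (f n t)) in T4.
  move: H n1 n2 n3 T1 T2 T3 T4; rewrite !ler_norml /=; set k1 := kob _ _.
  set k2 := kob _ _; set k3 := kob _ _; set k4 := kob _ _; set k5 := kob _ _; set k6 := kob _ _.
  set v := _^-1 => /andP[h1 h2] *; apply/andP; split; lra.
exists sigma; split.
- exact: ltW.
- by apply: limE; [rewrite lexx ltW|move=> n; have [] := fP n].
- by apply: limE; [rewrite lexx ltW|move=> n; have [] := fP n].
- exact: sO.
- move=> s t /andP[s0 sD] /andP[t0 tD]; have [st|/ltW ts] := leP s t.
    by rewrite main// distrC ger0_norm ?subr_ge0.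
  by rewrite kob_sym main// ger0_norm ?subr_ge0.
Qed.

(* Both X and Z are close to the midpoint m of a geodesic from Y to W. *)
Lemma hyperbolic_quadrilateral : gromov_hyperbolic O kob -> exists delta : R,
  forall X Y Z W (a : R), O X -> O Y -> O Z -> O W ->
    kob Y X <= a -> kob X W <= a -> kob Y Z <= a -> kob Z W <= a -> a < kob Y W ->
    kob X Z <= 2 * a - kob Y W + delta.
Proof.
move=> [delta [delta0 thin]]; exists (4 * delta).
move=> X Y Z W a OX OY OZ OW YX XW YZ ZW aD; set D := kob Y W in aD *.
have D0 : 0 < D by apply: le_lt_trans aD; apply: le_trans YX; exact: kob_ge0.
have WY : kob W Y = D by rewrite kob_sym.
have [|s3 g3] := @geodesic_exists W Y OW OY; first by rewrite WY.
rewrite WY in g3; pose m := s3 (D / 2).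
have mI : 0 <= D / 2 <= D by apply/andP; split; lra.
have [_ g3W g3Y g3O g3d] := g3.
have Om : O m by exact: g3O.
have mW : kob W m = D / 2.
  by rewrite -g3W g3d// ?lexx ?ltW// sub0r normrN gtr0_norm// divr_gt0.
have mY : kob Y m = D / 2.
  rewrite -g3Y g3d//; last by rewrite lexx ltW.
  by rewrite ger0_norm; lra.
have close P : O P -> kob Y P <= a -> kob P W <= a -> kob m P <= a - D / 2 + 2 * delta.
  move=> OP YP PW; have T := kob_tri Oo Oc OY OP OW; rewrite -/D in T.
  (* Since a < D, P is at positive distance from both Y and W, as [geodesic_exists] demands. *)
  have [|s1 g1] := @geodesic_exists Y P OY OP; first lra.
  have [|s2 g2] := @geodesic_exists P W OP OW; first lra.
  have [_ _ side] := thin _ _ _ _ _ _ _ _ _ _ _ _ g1 g2 g3.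
  have [|q [Hq mq]] := side m; first by exists (D / 2).
  (* If q lies on Y P, it is at least D / 2 - delta away from Y, which leaves at most a - D / 2 +
     delta from q to P; likewise from W. *)
  case: Hq => -[s /= sI sq].
  - have [_ s1Y s1P s1O s1d] := g1; have Oq : O q by rewrite -sq; exact: s1O.
    have [s0 sl] := andP sI.
    have q1 : kob Y q = s by rewrite -s1Y -sq s1d// ?sub0r ?normrN ?ger0_norm// lexx; lra.
    have q2 : kob q P = kob Y P - s.
      by rewrite -[in LHS]s1P -sq s1d// ?lexx ?andbT; [rewrite distrC ger0_norm ?subr_ge0|lra].
    have T1 := kob_tri Oo Oc OY Oq Om; have T2 := kob_tri Oo Oc Om Oq OP.
    rewrite (kob_sym _ q m) in T1; lra.
  - have [_ s2P s2W s2O s2d] := g2; have Oq : O q by rewrite -sq; exact: s2O.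
    have [s0 sl] := andP sI.
    have q1 : kob P q = s by rewrite -s2P -sq s2d// ?sub0r ?normrN ?ger0_norm// lexx; lra.
    have q2 : kob q W = kob P W - s.
      by rewrite -[in LHS]s2W -sq s2d// ?lexx ?andbT; [rewrite distrC ger0_norm ?subr_ge0|lra].
    have T1 := kob_tri Oo Oc OW Oq Om; have T2 := kob_tri Oo Oc Om Oq OP.
    rewrite (kob_sym _ q m) (kob_sym _ W q) in T1; rewrite (kob_sym _ q P) in T2; lra.
have := close X OX YX XW; have := close Z OZ YZ ZW; have := kob_tri Oo Oc OX Om OZ.
by rewrite (kob_sym _ X m); lra.
Qed.

End Geodesics.

(** * Disks near the boundary *)

(* pt p x u w z = (1 - w) (p + z u) + w x, with complex w.  Locked, as is pairing, to
   keep unification from unfolding matrix operations. *)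
HB.lock Definition pt (R : realType) (d : nat) (p x u : Cd R d) (w z : Cplx R) : Cd R d :=
  p + z *: u + w *: (x - (p + z *: u)).

Section Boundary.
Variables (R : realType) (d : nat).
Local Notation C := (Cplx R).
Local Notation Re := (@complex.Re R).
Local Notation Im := (@complex.Im R).
Local Notation r2c := (@r2c R).
Local Notation V := (Cd R d).
Variable O : set V.
Hypotheses (Oo : open O) (Oc : convex_set_Cd O).
Local Notation kob := (kobayashi O).

Lemma scale_small (a e : R) : 0 <= a -> 0 < e -> exists2 s : R, 0 < s <= 1 & s * a < e.
Proof.
move=> a0 e0; exists (Num.min 1 (e / (a + 1))).
  by rewrite lt_min ltr01 divr_gt0 ?ltr_wpDl//= ge_min lexx.
apply: le_lt_trans (_ : e / (a + 1) * a < _).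
  by rewrite ler_wpM2r// ge_min lexx orbT.
by rewrite mulrAC ltr_pdivrMr ?ltr_wpDl// ltr_pM2l// ltrDl.
Qed.

(** Separate at a point slightly nearer to x that is still outside [O]; then w is strictly on the
    other side. *)
Lemma separation_closure w : O !=set0 -> ~ closure O w ->
  exists A w', (forall z, O z -> Re (pairing A (z - w')) < 0) /\
    0 < Re (pairing A (w - w')).
Proof.
move=> [x Ox] ncw.
have [s /andP[s0 s1] nO] : exists2 s : R, 0 < s < 1 & ~ O (w + r2c s *: (x - w)).
  apply: contrapT => H; apply: ncw; apply/closure_rnorm => e e0.
  have [s /andP[s0 s1] sx] := scale_small (rnorm_ge0 (x - w)) e0.
  exists (w + r2c (s / 2) *: (x - w)).
    by apply: contrapT => nO; apply: H; exists (s / 2) => //; apply/andP; split; lra.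
  rewrite addrAC subrr add0r rnormZ cmod_r2c gtr0_norm ?divr_gt0//.
  apply: le_lt_trans sx; rewrite ler_wpM2r ?rnorm_ge0//; lra.
have [A A0] := separation Oo Oc (ex_intro _ x Ox) nO.
exists A, (w + r2c s *: (x - w)); split => //.
have := A0 x Ox; rewrite !opprD !addrA subrr sub0r.
rewrite pairingD !pairingN !pairingZ !pairingB !ReImE; nra.
Qed.

Lemma affine_disk (phi : C -> V) (t : C) : O !=set0 ->
  (forall z, cmod z < 1 -> cdiff phi z) ->
  (forall z, cmod z < 1 -> closure O (phi z)) -> cmod t < 1 -> t != 0 ->
  forall z : C, cmod z <= 1 ->
  closure O (phi 0 + z *: (r2c ((1 - cmod t) / (2 * cmod t)) *: (phi t - phi 0))).
Proof.
move=> On phid phicl t1 tn0 z z1; apply: contrapT => nc.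
have [A [w [A0 Aw]]] := separation_closure On nc.
have Acl y : closure O y -> Re (pairing A (y - w)) <= 0 by exact: halfplane_closure.
have := @schwarz_halfplane R (fun z => pairing A (phi z - w)) _ _ t t1.
have H1 z' : cmod z' < 1 -> cdiff (fun z => pairing A (phi z - w)) z'.
  by move=> z'1; apply: cdiff_pairing; apply: cdiffB; [exact: phid|exact: cdiff_cst].
have H2 z' : cmod z' < 1 -> Re (pairing A (phi z' - w)) <= 0.
  by move=> z'1; exact/Acl/phicl.
move=> /(_ H1 H2) {H1 H2}; rewrite -pairingB opprB addrA subrK.
set u := phi t - phi 0; set g := pairing A (phi 0 - w) => H.
have t0 : 0 < cmod t by rewrite cmod_gt0.
(* The inverse of the Schwarz constant, so that the functional moves by no more than its distance to
   the boundary of the half-plane. *)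
pose k := (1 - cmod t) / (2 * cmod t).
have k0 : 0 < k by rewrite divr_gt0 ?mulr_gt0 ?subr_gt0.
have Hk : k * cmod (pairing A u) <= - Re g.
  apply: le_trans (ler_wpM2l (ltW k0) H) _; rewrite mulrA.
  have -> : k * (2 * cmod t / (1 - cmod t)) = 1.
    have tn1 : 1 - cmod t != 0 by rewrite subr_eq0 eq_sym lt_eqF.
    by rewrite /k; field; rewrite (lt0r_neq0 t0) tn1.
  by rewrite mul1r.
move: Aw; rewrite addrAC pairingD !pairingZ -/g -/k cReD ltNge => /negP; apply.
have : Re (z * (r2c k * pairing A u)) <= k * cmod (pairing A u).
  apply: le_trans (ler_norm _) _; apply: le_trans (Re_le_cmod _) _.
  rewrite !cmodM cmod_r2c (gtr0_norm k0) ler_piMl// mulr_ge0 ?cmod_ge0//.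
  exact: ltW.
lra.
Qed.

(** A line inside the closure could be translated into [O]: x + z v is a convex combination of a
    point of the line and a point of [O] slightly beyond x as seen from p. *)
Lemma exits_closure p v : C_proper O -> O !=set0 -> v != 0 ->
  exists z : C, ~ closure O (p + z *: v).
Proof.
move=> Opr [x Ox] v0; apply: contrapT => H.
have cl z : closure O (p + z *: v) by apply: contrapT => nc; apply: H; exists z.
apply: Opr; exists x, v; split => // z.
have [r r0 xO] := open_ball Oo Ox.
have [t /andP[t0 t1] tx] := scale_small (rnorm_ge0 (x - p)) r0.
have Ox' : O (x + r2c t *: (x - p)).
  by apply: xO; rewrite addrAC subrr add0r rnormZ cmod_r2c gtr0_norm.
pose s := (1 + t)^-1; have t10 : 0 < 1 + t by lra.
have s01 : 0 < s <= 1 by rewrite invr_gt0 t10 invf_le1//; lra.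
have := conv_interior_closure Oo Oc Ox' (cl (z / r2c (1 - s))) s01.
have sn : r2c (1 - s) != 0.
  rewrite -cmod_eq0 cmod_r2c normr_eq0 subr_eq0 eq_sym lt_eqF//.
  by rewrite invf_lt1//; lra.
congr (O _); rewrite scalerDr scalerA [_ * (z / _)]mulrC divfK//.
have E : r2c s *: (x + r2c t *: (x - p)) = x - r2c (1 - s) *: p.
  have e1 : r2c (1 - s) = r2c s * r2c t.
    by rewrite -r2cM; congr r2c; rewrite /s; field; rewrite gt_eqF.
  have e2 : r2c s + r2c s * r2c t = 1 by rewrite -e1 -r2cD addrC subrK r2c1.
  by rewrite scalerDr scalerA scalerBr addrA -scalerDl e2 scale1r e1.
by rewrite E addrC addrA subrK.
Qed.

(** Rescale by the supremum of the admissible radii, which [exits_closure] bounds. The exit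
    direction may vary with e. *)
Lemma maximal_disk p v : C_proper O -> O !=set0 -> v != 0 ->
  (forall z : C, cmod z <= 1 -> closure O (p + z *: v)) ->
  exists v' : V, [/\ v' != 0, forall z : C, cmod z < 1 -> closure O (p + z *: v') &
    forall e : R, 0 < e -> exists z : C, [/\ 1 <= cmod z, cmod z <= 1 + e &
      ~ closure O (p + z *: v')]].
Proof.
move=> Opr On v0 v1.
pose S := [set r : R | 0 <= r /\ forall z : C, cmod z <= r -> closure O (p + z *: v)].
have S1 : S 1 by split.
have [z0 nz0] := exits_closure p Opr On v0.
have Sub : has_sup S.
  split; first by exists 1.
  exists (cmod z0) => r [_ rP]; rewrite leNgt; apply/negP => /ltW/rP; exact: nz0.
pose r := sup S; have r1 : 1 <= r by apply: ub_le_sup => //; exact: Sub.2.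
have r0 : 0 < r by lra.
have rn : r2c r != 0 by rewrite -cmod_eq0 cmod_r2c normr_eq0 gt_eqF.
have in1 z : cmod z < 1 -> closure O (p + z *: (r2c r *: v)).
  move=> z1; have [s [_ sP] zs] : exists2 s, S s & cmod (z * r2c r) < s.
    apply: sup_gt; first exact: Sub.1.
    by rewrite cmodM cmod_r2c gtr0_norm// gtr_pMl.
  by rewrite scalerA; apply: sP; exact: ltW.
exists (r2c r *: v); split => //; first by rewrite scaler_eq0 (negbTE rn).
move=> e e0; have [z zr nz] : exists2 z : C, cmod z <= r * (1 + e) & ~ closure O (p + z *: v).
  apply: contrapT => H.
  have : r * (1 + e) <= r.
    apply: ub_le_sup; first exact: Sub.2.
    split; first by rewrite mulr_ge0//; lra.
    by move=> z zr; apply: contrapT => nz; apply: H; exists z.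
  by rewrite leNgt ltr_pMr//; lra.
have zE : z *: v = (z / r2c r) *: (r2c r *: v) by rewrite scalerA divfK.
exists (z / r2c r); rewrite -zE; split => //.
  rewrite leNgt; apply/negP => /in1; rewrite -zE; exact: nz.
by rewrite cmodM cmodV cmod_r2c gtr0_norm// ler_pdivrMr// mulrC.
Qed.

Lemma pt_sub (p x u : V) (w z z' : C) :
  pt p x u w z - pt p x u w z' = ((1 - w) * (z - z')) *: u.
Proof.
have E a : pt p x u w a = ((1 - w) * a) *: u + ((1 - w) *: p + w *: x).
  rewrite pt.unlock; set y := p + a *: u.
  rewrite scalerBr addrA addrAC -{1}[y]scale1r -scalerBl /y scalerDr scalerA.
  by rewrite addrA [X in _ = X + _]addrC.
have sub2 (a b c : V) : a + c - (b + c) = a - b by rewrite opprD addrACA subrr addr0.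
by rewrite (E z) (E z') sub2 -scalerBl -mulrBr.
Qed.

Lemma pairing_pt A (p x u : V) (w z : C) : pairing A u = 0 ->
  pairing A (pt p x u w z - p) = w * pairing A (x - p).
Proof.
move=> Au; rewrite pt.unlock !(opprD, pairingD, pairingN, pairingZ) Au.
ring.
Qed.

Section Box.
Variables (p x u : V) (r k : R).
Hypothesis (xO : forall z, rnorm (z - x) < r -> O z).
Hypothesis (uO : forall z : C, cmod z < 1 -> closure O (p + z *: u)).
Hypotheses (k0 : 0 <= k) (kr : k * (rnorm (x - p) + rnorm u) < r).

(** The height may vary by the relative amount k, independently of z: the perturbation amounts to
    moving x inside its ball, and k does not depend on s. *)
Lemma pt_in_box (s : R) (l z : C) : 0 < s <= 1 -> cmod l < 1 -> cmod z < 1 ->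
  O (pt p x u (r2c s * (1 + r2c k * l)) z).
Proof.
move=> s01 l1 z1; set y := p + z *: u.
have Ox' : O (x + (r2c k * l) *: (x - y)).
  apply: xO; rewrite addrAC subrr add0r rnormZ cmodM cmod_r2c ger0_norm//.
  apply: le_lt_trans kr; apply: ler_pM; rewrite ?mulr_ge0 ?cmod_ge0 ?rnorm_ge0//.
    by rewrite ler_piMr// ltW.
  rewrite /y opprD addrA; apply: le_trans (rnormB _ _) _; rewrite lerD2l rnormZ.
  by rewrite ler_piMl ?rnorm_ge0// ltW.
have := conv_interior_closure Oo Oc Ox' (uO z1) s01; rewrite -/y convE.
have E : x + (r2c k * l) *: (x - y) - y = (1 + r2c k * l) *: (x - y).
  by rewrite addrAC scalerDl scale1r.
by rewrite E scalerA pt.unlock.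
Qed.

(** One holomorphic disk, of height s (1 + j l) and horizontal position [mob a (t l)], read at l = 0
    and l = 1/2. The sign t gives the horizontal direction. *)
Lemma kob_box_step (s a t j : R) : 0 < s <= 1 -> -1 < a < 1 -> t ^+ 2 = 1 ->
  0 <= j <= k ->
  kob (pt p x u (r2c s) (r2c a))
      (pt p x u (r2c (s * (1 + j / 2))) (r2c ((a + t / 2) / (1 + a * t / 2))))
  <= poincare0 (r2c 2^-1).
Proof.
move=> s01 /andP[a1 a2] tt /andP[j0 jk].
have a1c : cmod (r2c a) < 1 by rewrite cmod_r2c ltr_norml a1.
have t1 : `|t| = 1.
  by apply/eqP; rewrite -(@eqrXn2 _ 2)// ?expr1n -?tt ?real_normK ?num_real// normr_ge0.
have [q [q0 q1 kq]] : exists q : R, [/\ 0 <= q, q <= 1 & j = k * q].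
  have [k00|kn0] := eqVneq k 0.
    by exists 0; split => //; rewrite mulr0; apply/eqP; rewrite eq_le j0 -k00 jk.
  have kp : 0 < k by rewrite lt_def kn0.
  exists (j / k); split; [by rewrite divr_ge0|by rewrite ler_pdivrMr// mul1r|].
  by rewrite mulrC divfK.
pose f (l : C) := pt p x u (r2c s * (1 + r2c k * (r2c q * l))) (mob (r2c a) (r2c t * l)).
have tl1 (l : C) : cmod l < 1 -> cmod (r2c t * l) < 1.
  by rewrite cmodM cmod_r2c t1 mul1r.
have fO : hol_into O f.
  move=> l l1; split; last first.
    apply: pt_in_box => //; last by apply: mob_lt1 => //; exact: tl1.
    rewrite cmodM cmod_r2c ger0_norm//.
    by apply: le_lt_trans l1; rewrite ler_piMl ?cmod_ge0.
  have hz (b c : C) : cdiff (fun l => b + c * l) l.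
    apply: cdiffD; first exact: cdiff_cst.
    by apply: cdiffM; [exact: cdiff_cst|exact: cdiff_id].
  have h1 : cdiff (fun l => mob (r2c a) (r2c t * l)) l.
    apply: (@cdiff_comp R _ (mob (r2c a)) (fun l => r2c t * l)).
      by apply: cdiffM; [exact: cdiff_cst|exact: cdiff_id].
    have -> : mob (r2c a) = (fun w => (1 * w + r2c a) / (conjc (r2c a) * w + 1)).
      by apply/funext => w; rewrite mul1r.
    by apply/cdiff_mobius/mob_den => //; exact: tl1.
  have h2 : cdiff (fun l => p + mob (r2c a) (r2c t * l) *: u) l.
    apply: cdiffD; first exact: cdiff_cst.
    by apply: cdiffZ => //; exact: cdiff_cst.
  rewrite /f pt.unlock.
  apply: (@cdiffD _ _ (fun l => p + mob (r2c a) (r2c t * l) *: u)) => //.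
  apply: (@cdiffZ _ _ (fun l => r2c s * (1 + r2c k * (r2c q * l)))).
    apply: cdiffM; first exact: cdiff_cst.
    apply: cdiffD; first exact: cdiff_cst.
    apply: cdiffM; first exact: cdiff_cst.
    by apply: cdiffM; [exact: cdiff_cst|exact: cdiff_id].
  by apply: cdiffB => //; exact: cdiff_cst.
have h1 : cmod (r2c 2^-1) < 1 by rewrite cmod_r2c gtr0_norm ?invr_gt0//; lra.
have := kob_disc0 fO h1.
have -> : f 0 = pt p x u (r2c s) (r2c a).
  by rewrite /f !mulr0 addr0 mulr1 mob0.
have -> // : f (r2c 2^-1) =
  pt p x u (r2c (s * (1 + j / 2))) (r2c ((a + t / 2) / (1 + a * t / 2))).
have e1 : r2c s * (1 + r2c k * (r2c q * r2c 2^-1)) = r2c (s * (1 + j / 2)).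
  by rewrite kq !r2cE; ring.
have e2 : mob (r2c a) (r2c t * r2c 2^-1) = r2c ((a + t / 2) / (1 + a * t / 2)).
  rewrite /mob [conjc _]conjc_real -/(r2c a) -!r2cM -r2c1 -!r2cD -r2cV -r2cM.
  by congr r2c; congr (_ / _); ring.
by rewrite /f e1 e2.
Qed.

(* hradius j = tanh (j * poincare0 (1/2)), because (1 + 1/2) / (1 - 1/2) = 3. *)
Definition hradius (j : nat) : R := (3 ^+ j - 1) / (3 ^+ j + 1).

Lemma hradius_itv j : 0 <= hradius j < 1.
Proof.
have : 1 <= 3 ^+ j :> R by rewrite exprn_ege1// ler1n.
by move=> h; rewrite /hradius ltr_pdivrMr ?divr_ge0//=; lra.
Qed.

Lemma hradiusS j : (hradius j + 2^-1) / (1 + hradius j / 2) = hradius j.+1.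
Proof.
have h : 1 <= 3 ^+ j :> R by rewrite exprn_ege1// ler1n.
rewrite /hradius exprS; move: (3 ^+ j) h => X h; field.
by rewrite !gt_eqF//=; lra.
Qed.

Lemma hradiusP j : (hradius j.+1 - 2^-1) / (1 - hradius j.+1 / 2) = hradius j.
Proof.
have h : 1 <= 3 ^+ j :> R by rewrite exprn_ege1// ler1n.
rewrite /hradius exprS; move: (3 ^+ j) h => X h; field.
by rewrite !gt_eqF//=; lra.
Qed.

Let box (s : R) (j : nat) := pt p x u (r2c s) (r2c (hradius j)).

Lemma box_in s j : 0 < s <= 1 -> O (box s j).
Proof.
move=> s01; have := @pt_in_box s 0 (r2c (hradius j)) s01.
rewrite mulr0 addr0 mulr1; apply; first by rewrite cmod0.
by have /andP[a b] := hradius_itv j; rewrite cmod_r2c ger0_norm.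
Qed.

(** The cost does not depend on i: i = 0 stays at one height, i = k climbs as fast as the box
    allows. *)
Lemma kob_box_up (s i : R) (j N : nat) : 0 <= i <= k -> 0 < s -> s * (1 + i / 2) ^+ N <= 1 ->
  kob (box s j) (box (s * (1 + i / 2) ^+ N) (j + N)) <= N%:R * poincare0 (r2c 2^-1).
Proof.
move=> ik s0; have b1 : 1 <= 1 + i / 2 by case/andP: ik => i0 _; lra.
elim: N => [|N IH] sN; first by rewrite expr0 mulr1 addn0 kob_xx mul0r.
have sN1 : 0 < s * (1 + i / 2) ^+ N by rewrite mulr_gt0// exprn_gt0//; lra.
have sN2 : s * (1 + i / 2) ^+ N <= 1.
  by apply: le_trans sN; rewrite ler_pM2l// exprS ler_peMl// exprn_ge0//; lra.
have s1 : 0 < s <= 1.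
  by rewrite s0/=; apply: le_trans sN2; rewrite ler_peMr ?(ltW s0)// exprn_ege1.
apply: le_trans (kob_tri Oo Oc (box_in j s1) (@box_in (s * (1 + i / 2) ^+ N) (j + N) _) (box_in _ _)) _.
- by rewrite sN1.
- by rewrite sN andbT mulr_gt0// exprn_gt0//; lra.
rewrite -[N.+1%:R]natr1 mulrDl mul1r; apply: lerD; first exact: IH.
have /andP[a0 a1] := hradius_itv (j + N).
have := @kob_box_step (s * (1 + i / 2) ^+ N) (hradius (j + N)) 1 i.
rewrite mulr1 mul1r hradiusS addnS [_ ^+ N.+1]exprSr mulrA; apply => //.
- by rewrite sN1.
- by rewrite a1 andbT; lra.
- by rewrite expr1n.
Qed.

(** Only the index j goes down; the height still rises. *)
Lemma kob_box_down (s i : R) (j N : nat) : 0 <= i <= k -> 0 < s -> s * (1 + i / 2) ^+ N <= 1 ->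
  kob (box s (j + N)) (box (s * (1 + i / 2) ^+ N) j) <= N%:R * poincare0 (r2c 2^-1).
Proof.
move=> ik s0; have b1 : 1 <= 1 + i / 2 by case/andP: ik => i0 _; lra.
elim: N j => [|N IH] j sN; first by rewrite expr0 mulr1 addn0 kob_xx mul0r.
have sN1 : 0 < s * (1 + i / 2) ^+ N by rewrite mulr_gt0// exprn_gt0//; lra.
have sN2 : s * (1 + i / 2) ^+ N <= 1.
  by apply: le_trans sN; rewrite ler_pM2l// exprS ler_peMl// exprn_ge0//; lra.
have s1 : 0 < s <= 1.
  by rewrite s0/=; apply: le_trans sN2; rewrite ler_peMr ?(ltW s0)// exprn_ege1.
apply: le_trans (kob_tri Oo Oc (box_in _ s1) (@box_in (s * (1 + i / 2) ^+ N) j.+1 _) (box_in _ _)) _.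
- by rewrite sN1.
- by rewrite sN andbT mulr_gt0// exprn_gt0//; lra.
rewrite -[N.+1%:R]natr1 mulrDl mul1r addnS -addSn; apply: lerD; first exact: IH.
have /andP[a0 a1] := hradius_itv j.+1.
have := @kob_box_step (s * (1 + i / 2) ^+ N) (hradius j.+1) (-1) i.
rewrite mulrN1 mulN1r !mulNr hradiusP [_ ^+ N.+1]exprSr mulrA; apply => //.
- by rewrite sN1.
- by rewrite a1 andbT; lra.
- by rewrite sqrrN expr1n.
Qed.

End Box.

End Boundary.

(** * Lower bounds in the box, and the contradiction with hyperbolicity *)

Section Final.
Variables (R : realType) (d : nat).
Local Notation C := (Cplx R).
Local Notation Re := (@complex.Re R).
Local Notation Im := (@complex.Im R).
Local Notation r2c := (@r2c R).
Local Notation V := (Cd R d).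
Variable O : set V.
Hypotheses (Oo : open O) (Oc : convex_set_Cd O) (Opr : C_proper O).
Local Notation kob := (kobayashi O).

Lemma poincare0_half : poincare0 (r2c 2^-1) = ln 3 / 2 :> R.
Proof.
rewrite /poincare0 cmod_r2c gtr0_norm ?invr_gt0// mulrC; congr (ln _ * _).
by field.
Qed.

(** A functional separating the outside point at [xi] is affine along the slice and takes its
    boundary value at [xi]. Its distances to that value at the two ends have ratio xi / (xi -
    hradius N), at least 3^N / 3: the loss ln 3 is independent of N. *)
Lemma box_horizontal (p x u : V) (s xi : R) (N : nat) : O x -> 0 < s <= 1 ->
  (forall z : C, cmod z < 1 -> closure O (p + z *: u)) ->
  1 <= xi -> xi <= 1 + (3 ^+ N)^-1 -> ~ O (pt p x u (r2c s) (r2c xi)) ->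
  N%:R * ln 3 - ln 3 <=
  2 * kob (pt p x u (r2c s) (r2c (hradius R 0))) (pt p x u (r2c s) (r2c (hradius R N))).
Proof.
move=> Ox s01 uO xi1 xi2 nO.
have ptO (a : R) : 0 <= a < 1 -> O (pt p x u (r2c s) (r2c a)).
  move=> /andP[a0 a1]; have a1c : cmod (r2c a) < 1 by rewrite cmod_r2c ger0_norm.
  rewrite pt.unlock -(convE s (p + r2c a *: u) x).
  exact: (conv_interior_closure Oo Oc Ox (uO _ a1c) s01).
set q := pt p x u (r2c s) (r2c xi) in nO.
have [A A0] := separation Oo Oc (ex_intro _ x Ox) nO.
have [m mE] : exists m : C, forall a : R,
    pairing A (pt p x u (r2c s) (r2c a)) - pairing A q = r2c (a - xi) * m.
  exists ((1 - r2c s) * pairing A u) => a.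
  by rewrite -pairingB /q pt_sub pairingZ r2cB; ring.
have A0' z : O z -> Re (pairing A z - pairing A q) < 0.
  by move=> /A0; rewrite pairingB.
have r0 := hradius_itv R 0; have rN := hradius_itv R N.
have K : ln (cmod (r2c (hradius R 0 - xi) * m)) - ln (cmod (r2c (hradius R N - xi) * m)) <=
    2 * kob (pt p x u (r2c s) (r2c (hradius R N))) (pt p x u (r2c s) (r2c (hradius R 0))).
  rewrite -(mE (hradius R 0)) -(mE (hradius R N)).
  exact: (kob_ge_halfplane Oo Oc (ptO _ rN) (ptO _ r0) A0').
rewrite kob_sym; refine (le_trans _ K).
rewrite 2!cmodM 2!cmod_r2c {K}.
have m0 : 0 < cmod m.
  have := A0' _ (ptO _ r0); rewrite cmod_gt0; apply: contraTneq => me.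
  by rewrite (mE (hradius R 0)) me mulr0 ltxx.
have X1 : 1 <= 3 ^+ N :> R by rewrite exprn_ege1// ler1n.
have X0 : 0 < 3 ^+ N :> R by lra.
have R0 : hradius R 0 = 0 by rewrite /hradius expr0 subrr mul0r.
rewrite R0 sub0r normrN.
have -> : `|hradius R N - xi| = xi - hradius R N.
  by rewrite ltr0_norm ?opprB// subr_lt0; case/andP: rN => _ h; apply: lt_le_trans xi1.
rewrite [`|xi|]ger0_norm; last lra.
have d0 : 0 < xi - hradius R N by case/andP: rN => _ h; lra.
(* One 3^-N comes from [xi2], the other two from 1 - hradius N = 2 / (3^N + 1). *)
have d1 : xi - hradius R N <= 3 / 3 ^+ N.
  have -> : hradius R N = 1 - 2 / (3 ^+ N + 1) by rewrite /hradius; field; rewrite gt_eqF//; lra.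
  have : (3 ^+ N + 1)^-1 <= (3 ^+ N)^-1 :> R by rewrite lef_pV2 ?posrE//; lra.
  move: xi2; lra.
rewrite -ln_div ?posrE ?mulr_gt0//; last lra.
rewrite mulr_natl -lnXn// -ln_div ?posrE//.
rewrite ler_ln ?posrE ?divr_gt0 ?mulr_gt0//; last lra.
rewrite -mulf_div divff ?gt_eqF// mulr1 ler_pdivlMr//.
apply: le_trans (_ : 3 ^+ N / 3 * (3 / 3 ^+ N) <= _).
  by rewrite ler_wpM2l// divr_ge0// ltW.
have -> // : 3 ^+ N / 3 * (3 / 3 ^+ N) = 1 :> R by field; rewrite gt_eqF.
Qed.

(** A functional that vanishes on u sees only the height, to which its value is proportional. *)
Lemma box_vertical (p x u : V) (s s' : R) (z : C) L :
  (forall z, O z -> Re (pairing L (z - p)) < 0) -> O x -> pairing L u = 0 ->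
  0 < s -> 0 < s' -> O (pt p x u (r2c s) z) -> O (pt p x u (r2c s') z) ->
  ln (s' / s) <= 2 * kob (pt p x u (r2c s) z) (pt p x u (r2c s') z).
Proof.
move=> L0 Ox Lu s0 s'0 O1 O2.
have L0' z' : O z' -> Re (pairing L z' - pairing L p) < 0.
  by move=> /L0; rewrite pairingB.
have K : ln (cmod (r2c s' * pairing L (x - p))) - ln (cmod (r2c s * pairing L (x - p))) <=
    2 * kob (pt p x u (r2c s) z) (pt p x u (r2c s') z).
  rewrite -(pairing_pt p x (r2c s') z Lu) -(pairing_pt p x (r2c s) z Lu).
  rewrite (pairingB L (pt p x u (r2c s') z) p) (pairingB L (pt p x u (r2c s) z) p).
  exact: (kob_ge_halfplane Oo Oc O1 O2 L0').
refine (le_trans _ K).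
rewrite 2!cmodM 2!cmod_r2c (gtr0_norm s0) (gtr0_norm s'0) {K}.
have m0 : 0 < cmod (pairing L (x - p)).
  by rewrite cmod_gt0; apply/eqP => e; have := L0 _ Ox; rewrite e ltxx.
by rewrite -ln_div ?posrE ?mulr_gt0// -mulf_div divff ?gt_eqF// mulr1.
Qed.

(* Y = box s 0, W = box s (2N), and the two almost midpoints are Z = box s N and
   X = box (s b^N) N. *)
Lemma no_affine_disk (p v : V) : gromov_hyperbolic O kob -> O !=set0 ->
  ~ O p -> v != 0 -> (forall z : C, cmod z <= 1 -> closure O (p + z *: v)) -> False.
Proof.
move=> hyp [x Ox] nOp v0 vO.
have On : O !=set0 by exists x.
have [delta quad] := hyperbolic_quadrilateral Oo Oc Opr hyp.
have [w [w0 wO wex]] := maximal_disk Oo Oc Opr On v0 vO.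
have [r r0 xO] := open_ball Oo Ox.
have [k /andP[k0 k1] kr'] := scale_small (addr_ge0 (rnorm_ge0 (x - p)) (rnorm_ge0 w)) r0.
have [L L0] := separation Oo Oc On nOp.
pose b := 1 + k / 2; have b1 : 1 < b by rewrite /b; lra.
have lb0 : 0 < ln b by rewrite ln_gt0.
have l30 : 0 < ln 3 :> R by rewrite ln_gt0// ltr1n.
(* The almost midpoints will be at least N ln b / 2 apart and at most ln 3 / 2 + delta; 1 < N
   ensures that Y W is longer than the sides. *)
have [N [N1 NP]] : exists N, (1 < N)%N /\ ln 3 + 2 * `|delta| < N%:R * ln b.
  exists (Num.truncn ((ln 3 + 2 * `|delta|) / ln b)).+2; split => //.
  by rewrite -ltr_pdivrMr//; apply: lt_trans (truncnS_gt _) _; rewrite ltr_nat.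
have N3 : 0 < (3 ^+ (N + N))^-1 :> R by rewrite invr_gt0 exprn_gt0.
have [z [z1 z2 nz]] := wex _ N3.
have zc0 : cmod z != 0 by rewrite gt_eqF//; lra.
have zn0 : r2c (cmod z) != 0 by rewrite -cmod_eq0 cmod_r2c normr_eq0.
(* The rotation puts the outside point on the positive real axis, where the chains run. *)
pose u : V := (z / r2c (cmod z)) *: w.
have uc : cmod (z / r2c (cmod z)) = 1.
  by rewrite cmodM cmodV cmod_r2c ger0_norm ?cmod_ge0// divff.
have un : rnorm u = rnorm w by rewrite rnormZ uc mul1r.
have uO (l : C) : cmod l < 1 -> closure O (p + l *: u).
  by move=> l1; rewrite scalerA; apply: wO; rewrite cmodM uc mulr1.
have kr : k * (rnorm (x - p) + rnorm u) < r by rewrite un.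
have zu : z *: w = r2c (cmod z) *: u by rewrite scalerA mulrC divfK.
(* Re (l L(u)) is nonpositive for all |l| < 1, and l can be rotated to make l L(u) real and
   nonnegative. *)
have Lu : pairing L u = 0.
  have [c c1 cL] := rotate_to_norm (pairing L u).
  have : closure O (p + (c / 2) *: u).
    by apply: uO; rewrite cmodM cmodV c1 -r2cn cmod_r2c normr_nat; lra.
  move=> /(halfplane_closure Oo Oc On L0); rewrite addrAC subrr add0r pairingZ.
  have -> : c / 2 * pairing L u = r2c (cmod (pairing L u) / 2).
    by rewrite r2cM -cL r2cV r2cn; ring.
  rewrite Re_r2c => h; apply/eqP; rewrite -cmod_eq0 eq_le cmod_ge0 andbT; lra.
have [e e0 eP] : exists2 e : R, 0 < e & forall y, O y -> e <= rnorm (y - (p + z *: w)).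
  apply: contrapT => H; apply: nz; apply/closure_rnorm => e e0.
  apply: contrapT => H'; apply: H; exists e => // y Oy; rewrite leNgt; apply/negP => ye.
  by apply: H'; exists y.
have [t /andP[t0 t1] te] := scale_small (rnorm_ge0 (x - (p + z *: w))) e0.
have bN : 1 <= b ^+ N by rewrite exprn_ege1// ltW.
have bN0 : 0 < b ^+ N by lra.
(* Low enough that raising the outside point by s keeps it outside [O], while the climb still ends
   at the height t, at most 1. *)
pose s := t / b ^+ N; have s0 : 0 < s by rewrite divr_gt0.
have sN : s * b ^+ N <= 1 by rewrite /s divfK ?gt_eqF.
have st : s <= t by rewrite /s ler_pdivrMr// ler_peMr// ltW.
have s1 : s <= 1 by lra.
have s01 : 0 < s <= 1 by rewrite s0.
have sN01 : 0 < s * b ^+ N <= 1 by rewrite sN andbT mulr_gt0.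
pose box (a : R) (j : nat) : V := pt p x u (r2c a) (r2c (hradius R j)).
have kk : 0 <= k <= k by rewrite lexx ltW.
have k00 : 0 <= (0 : R) <= k by rewrite lexx ltW.
have k0' : 0 <= k by exact: ltW.
have up := kob_box_up Oo Oc xO uO k0' kr.
have down := kob_box_down Oo Oc xO uO k0' kr.
have inO a j : 0 < a <= 1 -> O (box a j) by exact: (box_in Oo Oc xO uO k0' kr).
have s00 : s * (1 + 0 / 2) ^+ N = s by rewrite mul0r addr0 expr1n mulr1.
have s00' : s * (1 + 0 / 2) ^+ N <= 1 by rewrite s00.
have YX : kob (box s 0%N) (box (s * b ^+ N) N) <= N%:R * poincare0 (r2c 2^-1).
  exact: (up s k 0%N N kk s0 sN).
have XW : kob (box (s * b ^+ N) N) (box s (N + N)) <= N%:R * poincare0 (r2c 2^-1).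
  by rewrite kob_sym; exact: (down s k N N kk s0 sN).
have YZ : kob (box s 0%N) (box s N) <= N%:R * poincare0 (r2c 2^-1).
  by have := up s 0 0%N N k00 s0 s00'; rewrite s00.
have ZW : kob (box s N) (box s (N + N)) <= N%:R * poincare0 (r2c 2^-1).
  by rewrite kob_sym; have := down s 0 N N k00 s0 s00'; rewrite s00.
have YW : (N + N)%:R * ln 3 - ln 3 <= 2 * kob (box s 0%N) (box s (N + N)).
  apply: (box_horizontal Ox s01 uO z1 z2) => Oq.
  have := eP _ Oq; rewrite pt.unlock -zu addrAC subrr add0r rnormZ cmod_r2c gtr0_norm// leNgt.
  move=> /negP; apply; apply: le_lt_trans te.
  by rewrite ler_wpM2r ?rnorm_ge0.
have sb : s * b ^+ N / s = b ^+ N by rewrite mulrC mulKf ?gt_eqF.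
have sN0 : 0 < s * b ^+ N by rewrite mulr_gt0.
have ZX := box_vertical L0 Ox Lu s0 sN0 (inO s N s01) (inO _ N sN01).
rewrite sb in ZX.
have b0 : 0 < b by lra.
rewrite (lnXn N b0) -[ln b *+ N]mulr_natl in ZX.
rewrite poincare0_half in YX XW YZ ZW.
have := quad _ _ _ _ (N%:R * (ln 3 / 2)) (inO _ N sN01) (inO s 0%N s01) (inO s N s01)
  (inO s (N + N)%N s01) YX XW YZ ZW.
rewrite natrD in YW.
have H2 : N%:R * (ln 3 / 2) < kob (box s 0%N) (box s (N + N)).
  have N2 : 2 <= N%:R :> R by rewrite ler_nat.
  have : 2 * ln 3 <= N%:R * ln 3 :> R by rewrite ler_pM2r.
  move: YW; lra.
move=> /(_ H2); rewrite kob_sym.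
have := ler_norm delta; move: ZX YW NP; lra.
Qed.

End Final.

Unset Implicit Arguments.

Theorem theorem1p6 (R : realType) (d : nat) (Omega : set (Cd R d)) :
  open Omega -> convex_set_Cd Omega -> C_proper Omega ->
  gromov_hyperbolic Omega (kobayashi Omega) ->
  ~ exists phi : Cplx R -> Cd R d,
      [/\ holomorphic_on (unit_disk R) phi,
          (exists z w, unit_disk R z /\ unit_disk R w /\ phi z != phi w) &
          phi @` unit_disk R `<=` bdry Omega].
Proof.
move=> Oo Oc Opr hyp [phi [phid [z [w [z1 [w1 zw]]]] phib]].
have phicl y : cmod y < 1 -> closure Omega (phi y).
  by move=> y1; have [] := phib (phi y) (ex_intro2 _ _ y y1 erefl).
have c0 : cmod (0 : Cplx R) < 1 by rewrite cmod0.
have [t [t1 t0]] : exists t, cmod t < 1 /\ phi t != phi 0.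
  have [z0|z0] := eqVneq (phi z) (phi 0); last by exists z.
  by exists w; split => //; rewrite -z0 eq_sym.
have On : Omega !=set0.
  by have /closure_rnorm/(_ 1 ltr01)[y Oy _] := phicl 0 c0; exists y.
have nO : ~ Omega (phi 0).
  have [_] := phib (phi 0) (ex_intro2 _ _ 0 c0 erefl).
  by rewrite (interior_id _).1.
have tn0 : t != 0 by apply: contra_neq t0 => ->.
have phid' y : cmod y < 1 -> cdiff phi y by move=> y1; apply/cdiff_derivable/phid.
apply: (no_affine_disk Oo Oc Opr hyp On nO _ (affine_disk Oo Oc On phid' phicl t1 tn0)).
rewrite scaler_eq0 negb_or subr_eq0 t0 andbT -cmod_eq0 cmod_r2c normr_eq0.
rewrite gt_eqF// divr_gt0 ?subr_gt0// mulr_gt0// cmod_gt0//.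
Qed.
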